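(* Under the setting and Assumptions A1–A4 described in the context, suppose additionally that $\delta_t:=\mu^t\theta_1^t/2$ is constant, $\delta_t\equiv\delta$ for all $t\in\mathbb{N}$, and that the function $H:\mathbb{R}^{n_1\times n_2\times n_3}\times\mathbb{R}^{n_1\times n_2\times n_3}\to(-\infty,+\infty]$, $H(\mathcal{X},\mathcal{Y})=F(\mathcal{X})+\delta\|\mathcal{X}-\mathcal{Y}\|^2$, is a Kurdyka–Łojasiewicz (KL) function. Let $\{\mathcal{X}^t\}$ be the sequence generated by the TNNR iteration. Then $\{\mathcal{X}^t\}$ has finite length, $\sum_{t=0}^\infty\|\mathcal{X}^{t+1}-\mathcal{X}^t\|<+\infty$, and the whole sequence $\{\mathcal{X}^t\}$ converges to a critical point $\mathcal{X}^\star$ of $F$ (i.e. $0\in\partial F(\mathcal{X}^\star)$).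
   Context: Tensors: fix positive integers $n_1,n_2,n_3$, let $r=\min\{n_1,n_2\}$. For $\mathcal{X}\in\mathbb{R}^{n_1\times n_2\times n_3}$, $\|\mathcal{X}\|$ is the Frobenius norm (square root of the sum of squared entries) and $\langle\cdot,\cdot\rangle$ the entrywise inner product. $\bar{\mathcal{X}}\in\mathbb{C}^{n_1\times n_2\times n_3}$ is the (unnormalized) discrete Fourier transform of $\mathcal{X}$ along the third mode, $\bar{\mathcal{X}}(i,j,:)=F_{n_3}\mathcal{X}(i,j,:)$ with $F_{n_3}$ the $n_3\times n_3$ DFT matrix $(\omega^{(p-1)(q-1)})_{p,q}$, $\omega=e^{-2\pi\sqrt{-1}/n_3}$; $\bar X^{(k)}$ is its $k$-th frontal slice, and $\sigma_i^k(\mathcal{X})$ denotes the $i$-th largest singular value of $\bar X^{(k)}$, $i\in[r]$, $k\in[n_3]$. Assumption A1: $\rho:[0,\infty)\to[0,\infty)$ is differentiable and concave, $\rho'$ is Lipschitz continuous with constant $L_g$, and $\rho'(t)>0$ for all $t\ge 0$. Assumption A2: $f:\mathbb{R}^{n_1\times n_2\times n_3}\to[0,\infty)$ is continuously differentiable and $\nabla f$ is $L_f$-Lipschitz ($L_f>0$). Objective: for $\lambda>0$, $F(\mathcal{X})=\lambda\sum_{k=1}^{n_3}\rho\Big(\sum_{i=1}^r\rho\big(\rho(\sigma_i^k(\mathcal{X}))\big)\Big)+f(\mathcal{X})$. Assumption A3: $F$ is coercive ($F(\mathcal{X})\to+\infty$ as $\|\mathcal{X}\|\to\infty$) and bounded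 below. Weighted function: for weights $\alpha=(\alpha_k)_{k\in[n_3]}$, $\beta=(\beta_i^k)$, $\|\mathcal{X}\|_{\rho_\alpha^\beta}=\sum_{k=1}^{n_3}\sum_{i=1}^r\alpha_k\beta_i^k\rho(\sigma_i^k(\mathcal{X}))$. TNNR iteration: start from $\mathcal{X}^0$ and set $\mathcal{X}^{-1}=\mathcal{X}^0$; for every $t\ge 0$ the weights are $\alpha_k^t=\rho'\big(\sum_{i=1}^r\rho(\rho(\sigma_i^k(\mathcal{X}^t)))\big)$, $\beta_i^{k,t}=\rho'\big(\rho(\sigma_i^k(\mathcal{X}^t))\big)$, and $\mathcal{Y}^t=\mathcal{X}^t+\theta_1^t(\mathcal{X}^t-\mathcal{X}^{t-1})$, $\mathcal{Z}^t=\mathcal{X}^t+\theta_2^t(\mathcal{X}^t-\mathcal{X}^{t-1})$, $\mathcal{X}^{t+1}\in\arg\min_{\mathcal{X}}\ \lambda\|\mathcal{X}\|_{\rho_{\alpha^t}^{\beta^t}}+\langle\mathcal{X}-\mathcal{Y}^t,\nabla f(\mathcal{Z}^t)\rangle+\frac{\mu^t}{2}\|\mathcal{X}-\mathcal{Y}^t\|^2$ (a global minimizer). Assumption A4: for some fixed $\varepsilon\in(0,1)$ and all $t$: $\theta_1^t\in[0,(1-\varepsilon)/2)$, $\theta_2^t\in[0,1/2]$, $(\mu^t)$ is nonincreasing and $\mu^0\ge\mu^t\ge\max\{\theta_2^tL_f/\theta_1^t,\ (1-\theta_2^t)L_f/(1-\theta_1^t-\theta_1^{t+1}-\varepsilon)\}$.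 *)

(* Defs.v *)
From HB Require Import structures.
From mathcomp Require Import all_boot all_order all_algebra.
From mathcomp Require Import complex.
From mathcomp Require Import reals trigo.
From Stdlib Require Import ClassicalEpsilon.

Set Implicit Arguments.
Unset Strict Implicit.
Unset Printing Implicit Defensive.

Import Order.TTheory GRing.Theory Num.Theory.
Local Open Scope ring_scope.

Section EuclideanSpace.
Variables (R : realType) (I : finType).

Definition vec := {ffun I -> R}.

Definition dotv (u v : vec) : R := \sum_(i : I) u i * v i.
Definition normv (u : vec) : R := Num.sqrt (dotv u u).

Definition cvgv (u : nat -> vec) (x : vec) : Prop :=
  forall eps : R, 0 < eps -> exists N : nat, forall k : nat, (N <= k)%N ->
    normv (u k - x) < eps.
Definition cvgR (a : nat -> R) (l : R) : Prop :=
  forall eps : R, 0 < eps -> exists N : nat, forall k : nat, (N <= k)%N ->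
    `|a k - l| < eps.

Definition has_gradient (f : vec -> R) (g : vec -> vec) : Prop :=
  forall x : vec, forall eps : R, 0 < eps -> exists2 d : R, 0 < d &
    forall h : vec, normv h < d ->
      `|f (x + h) - f x - dotv (g x) h| <= eps * normv h.

(* Frechet (regular) subdifferential: v \in \hat\partial g(x) iff
   liminf_{y -> x, y <> x} (g y - g x - <v, y - x>) / ||y - x|| >= 0 *)
Definition frechet_subdiff (g : vec -> R) (x v : vec) : Prop :=
  forall eps : R, 0 < eps -> exists2 d : R, 0 < d &
    forall y : vec, normv (y - x) < d ->
      - (eps * normv (y - x)) <= g y - g x - dotv v (y - x).

Definition limiting_subdiff (g : vec -> R) (x v : vec) : Prop :=
  exists (xs vs : nat -> vec),
    [/\ cvgv xs x, cvgR (fun k => g (xs k)) (g x),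
        (forall k, frechet_subdiff g (xs k) (vs k)) & cvgv vs v].

Definition critical_point (g : vec -> R) (x : vec) : Prop :=
  limiting_subdiff g x 0.

Definition lower_semicontinuous (g : vec -> R) : Prop :=
  forall x : vec, forall eps : R, 0 < eps -> exists2 d : R, 0 < d &
    forall y : vec, normv (y - x) < d -> g x - eps < g y.

(* Kurdyka-Lojasiewicz property at xb (Attouch-Bolte-Redont-Soubeyran).
   Desingularizing function phi : [0,eta) -> [0,+oo), with derivative dphi
   on (0,eta).  The neighbourhood U of xb is taken to be an open ball (any
   neighbourhood contains one).  The inequality
   phi'(g x - g xb) * dist(0, \partial g(x)) >= 1 is written pointwise over
   the elements of \partial g(x) (this is what the infimum unfolds to;
   dist(0, emptyset) = +oo makes it vacuous). *)
Definition KL_at (g : vec -> R) (xb : vec) : Prop :=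
  exists (eta r : R) (phi dphi : R -> R),
    [/\ 0 < eta, 0 < r,
      [/\ phi 0 = 0,
          (forall s, 0 <= s < eta -> 0 <= phi s),
          (forall s, 0 <= s < eta -> forall e : R, 0 < e -> exists2 d : R, 0 < d &
             forall t, 0 <= t < eta -> `|t - s| < d -> `|phi t - phi s| < e),
          (forall s t a, 0 <= s < eta -> 0 <= t < eta -> 0 <= a <= 1 ->
             a * phi s + (1 - a) * phi t <= phi (a * s + (1 - a) * t)) &
          [/\ (forall s, 0 < s < eta -> forall e : R, 0 < e -> exists2 d : R, 0 < d &
                 forall h, `|h| < d -> 0 < s + h < eta ->
                   `|phi (s + h) - phi s - dphi s * h| <= e * `|h|),
              (forall s, 0 < s < eta -> forall e : R, 0 < e -> exists2 d : R, 0 < d &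
                 forall t, 0 < t < eta -> `|t - s| < d -> `|dphi t - dphi s| < e) &
              (forall s, 0 < s < eta -> 0 < dphi s)]] &
      forall x : vec, normv (x - xb) < r -> g xb < g x < g xb + eta ->
        forall v : vec, limiting_subdiff g x v ->
          1 <= dphi (g x - g xb) * normv v].

Definition KL_function (g : vec -> R) : Prop :=
  lower_semicontinuous g /\
  forall xb : vec, (exists v : vec, limiting_subdiff g xb v) -> KL_at g xb.

End EuclideanSpace.

Section Tensors.
Variables (R : realType) (n1 n2 n3 : nat).

Definition tidx := ('I_n1 * 'I_n2 * 'I_n3)%type.
Definition tensor := vec R tidx.

Definition omega : R[i] :=
  Complex (cos (2 * pi / n3%:R)) (- sin (2 * pi / n3%:R)).

Definition dft_slice (X : tensor) (k : 'I_n3) : 'M[R[i]]_(n1, n2) :=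
  \matrix_(i, j) \sum_(q < n3) omega ^+ (k * q) * Complex (X (i, j, q)) 0.

Definition rk := minn n1 n2.

Definition conjT m n (A : 'M[R[i]]_(m, n)) : 'M[R[i]]_(n, m) :=
  (map_mx (@conjc R) A)^T.

Definition unitary_mx n (U : 'M[R[i]]_n) : Prop := U *m conjT U = 1%:M.

Definition rdiag (s : nat -> R) : 'M[R[i]]_(n1, n2) :=
  \matrix_(i, j) if (i : nat) == j then Complex (s i) 0 else 0.

Definition is_svals (A : 'M[R[i]]_(n1, n2)) (s : nat -> R) : Prop :=
  [/\ forall i j : nat, (i <= j < rk)%N -> s j <= s i,
      forall i : nat, (i < rk)%N -> 0 <= s i,
      forall i : nat, (rk <= i)%N -> s i = 0 &
      exists (U : 'M[R[i]]_n1) (V : 'M[R[i]]_n2),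
        [/\ unitary_mx U, unitary_mx V & A = U *m rdiag s *m conjT V]].

Definition svals (A : 'M[R[i]]_(n1, n2)) : nat -> R :=
  epsilon (inhabits (fun _ : nat => 0 : R)) (is_svals A).

(* sigma_i^k(X), i-th largest singular value (0-based) of \bar X^{(k)} *)
Definition sigma (X : tensor) (k : 'I_n3) (i : nat) : R := svals (dft_slice X k) i.

Definition Fobj (lam : R) (rho : R -> R) (f : tensor -> R) (X : tensor) : R :=
  lam * (\sum_(k < n3) rho (\sum_(i < rk) rho (rho (sigma X k i)))) + f X.

Definition wnorm (rho : R -> R) (alpha : 'I_n3 -> R) (beta : 'I_n3 -> nat -> R)
    (X : tensor) : R :=
  \sum_(k < n3) \sum_(i < rk) alpha k * beta k i * rho (sigma X k i).

(* TNNR iteration: X^{-1} := X^0 *)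
Definition prevX (X : nat -> tensor) (t : nat) : tensor :=
  if t is t'.+1 then X t' else X 0%N.

Definition alphaw (rho drho : R -> R) (X : nat -> tensor) (t : nat) (k : 'I_n3) : R :=
  drho (\sum_(i < rk) rho (rho (sigma (X t) k i))).
Definition betaw (rho drho : R -> R) (X : nat -> tensor) (t : nat) (k : 'I_n3) (i : nat) : R :=
  drho (rho (sigma (X t) k i)).

Definition Yseq (X : nat -> tensor) (theta1 : nat -> R) (t : nat) : tensor :=
  [ffun i => X t i + theta1 t * (X t i - prevX X t i)].
Definition Zseq (X : nat -> tensor) (theta2 : nat -> R) (t : nat) : tensor :=
  [ffun i => X t i + theta2 t * (X t i - prevX X t i)].

Definition subproblem (lam : R) (rho drho : R -> R) (gradf : tensor -> tensor)
    (X : nat -> tensor) (theta1 theta2 mu : nat -> R) (t : nat) (W : tensor) : R :=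
  lam * wnorm rho (alphaw rho drho X t) (betaw rho drho X t) W
  + dotv (W - Yseq X theta1 t) (gradf (Zseq X theta2 t))
  + mu t / 2 * normv (W - Yseq X theta1 t) ^+ 2.

Definition is_TNNR_sequence (lam : R) (rho drho : R -> R) (gradf : tensor -> tensor)
    (X : nat -> tensor) (theta1 theta2 mu : nat -> R) : Prop :=
  forall (t : nat) (W : tensor),
    subproblem lam rho drho gradf X theta1 theta2 mu t (X t.+1)
    <= subproblem lam rho drho gradf X theta1 theta2 mu t W.

(* pairs (X, Y) of tensors as vectors indexed by tidx + tidx *)
Definition pfst (Z : vec R (tidx + tidx)%type) : tensor := [ffun i => Z (inl i)].
Definition psnd (Z : vec R (tidx + tidx)%type) : tensor := [ffun i => Z (inr i)].

Definition Hfun (lam : R) (rho : R -> R) (f : tensor -> R) (delta : R)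
    (Z : vec R (tidx + tidx)%type) : R :=
  Fobj lam rho f (pfst Z) + delta * normv (pfst Z - psnd Z) ^+ 2.

End Tensors.

(* Main.v *)
(** The singular values of the DFT slices are Lipschitz in the tensor (Weyl's
inequality), and [rho] lies between its tangent and its tangent minus a
quadratic.  The upper tangent, inserted in the minimality of [X t.+1], makes
[H (X t) (X t.-1)] decrease by a multiple of [normv (X t.+1 - X t) ^+ 2].  The
lower one gives, for all [W] and with [b], [K] independent of [t],
[F W >= F (X t.+1) - b (|X t.+1 - X t| + |X t - X t.-1|) |W - X t.+1| - K |W - X t.+1| ^+ 2].
This slope bound replaces the spectral subdifferential calculus: a point with
slope [c] is a limit of proximal points carrying Frechet subgradients of norm at
most [4 c], so the KL inequality applies to it; and at a cluster point the slope
vanishes, so [0] is a Frechet subgradient there.  The KL inequality and the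
sufficient decrease then give a decreasing potential that dominates the length
of the remaining path and keeps the iterates in the KL ball. *)
Require Import Defs.
From HB Require Import structures.
From mathcomp Require Import all_boot all_order all_algebra.
From mathcomp Require Import complex.
From mathcomp Require Import reals trigo.
From mathcomp Require Import perm spectral sesquilinear boolp classical_sets topology.
From mathcomp Require Import normedtype derive.
From mathcomp Require Import ring lra.
From Stdlib Require Import ClassicalEpsilon.
Import Order.TTheory GRing.Theory Num.Theory.
Local Open Scope ring_scope.

Set Implicit Arguments.
Unset Strict Implicit.
Unset Printing Implicit Defensive.

(** * Singular value decomposition *)

Section UnitaryMatrices.
Variable C : numClosedFieldType.
Local Open Scope sesquilinear_scope.

(** Where singular values coincide or vanish they are not differentiable in the tensor. The argument
    therefore treats [rho (sigma X k i)] as a merely Lipschitz quantity and differentiates only the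
    two outer layers of [rho]. Because [svals] is a choice, even its nonnegativity requires a
    singular value decomposition to exist; Weyl's inequality then compares any two admissible
    choices, so which one is made does not matter. The subproblem freezes the weights at [X t],
    whereas a bound at [X t.+1] needs the tangent there. Exchanging the weights costs a multiple of
    [|X t.+1 - X t| |W - X t.+1|], which has the form of a slope term. A slope bound compares values
    of [F] for all [W], so it passes to cluster points by continuity of [F]. Constancy of [delta]
    makes [H] one fixed function, so that a single KL inequality serves all late iterates. *)

Lemma gram_coef m n p (A : 'M[C]_(m, n)) (B : 'M[C]_(p, n)) i j :
  (A *m B ^t*) i j = \sum_k A i k * (B j k)^*.
Proof. by rewrite !mxE; apply: eq_bigr => k _; rewrite !mxE. Qed.

Lemma trmxC_mul m n p (A : 'M[C]_(m, n)) (B : 'M[C]_(n, p)) :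
  (A *m B) ^t* = B ^t* *m A ^t*.
Proof. by rewrite trmx_mul map_mxM. Qed.

(** The missing rows come from Gram-Schmidt applied to a basis of the space of rows orthogonal to
    those of [B]. *)
Lemma unitarymx_completion p n (B : 'M[C]_(p, n)) : B \is unitarymx ->
  exists2 W : 'M[C]_n, W \is unitarymx &
    forall (i : 'I_p) (j : 'I_n), i = j :> nat -> row j W = row i B.
Proof.
move=> uB; have pn : (p <= n)%N by rewrite -(mxrank_unitary uB) rank_leq_col.
have [q nE] : exists q, n = (p + q)%N by exists (n - p)%N; rewrite subnKC.
subst n.
have rkK : \rank (kermx (B ^t*)) = q.
  by rewrite mxrank_ker mxrank_map mxrank_tr (mxrank_unitary uB) addKn.
have [K frK KB] : exists2 K : 'M[C]_(q, p + q), row_free K & K *m B ^t* = 0.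
  have h : exists2 K : 'M[C]_(\rank (kermx (B ^t*)), p + q),
      row_free K & K *m B ^t* = 0.
    exists (row_base (kermx (B ^t*))); first exact: row_base_free.
    by apply/sub_kermxP; rewrite eq_row_base.
  by rewrite rkK in h.
have uS : schmidt K \is unitarymx by rewrite schmidt_unitarymx// leq_addl.
have SB : schmidt K *m B ^t* = 0.
  by apply/sub_kermxP; rewrite (eqmx_schmidt_free frK); exact/sub_kermxP.
exists (col_mx B (schmidt K)).
  apply/unitarymxP; rewrite tr_col_mx map_row_mx mul_col_row.
  move/unitarymxP: uB => ->; move/unitarymxP: uS => ->.
  rewrite SB; have -> : B *m (schmidt K) ^t* = 0.
    by rewrite -[B in B *m _]trmxCK -trmxC_mul SB trmx0 map_mx0.
  by rewrite -scalar_mx_block.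
move=> i j ij; have -> : j = lshift q i by apply: val_inj.
by apply/rowP => k; rewrite mxE [RHS]mxE col_mxEu.
Qed.
End UnitaryMatrices.

Lemma sort_perm (R : realDomainType) n (d : 'I_n -> R) :
  exists s : 'S_n, forall i j : 'I_n, (i <= j)%N -> d (s j) <= d (s i).
Proof.
pose t := [tuple d i | i < n].
have /tuple_permP [s hs] : perm_eq (sort_tuple (fun x y : R => y <= x) t) t.
  by rewrite perm_sort.
have hd i : d (s i) = nth 0 (sort (fun x y : R => y <= x) t) i.
  rewrite -[sort _ _]/(tval (sort_tuple _ t)) hs.
  by rewrite -(tnth_nth 0 [tuple tnth t (s i) | i < n]) tnth_mktuple tnth_mktuple.
exists s => i j ij; rewrite !hd.
have tot : total (fun x y : R => y <= x) by move=> x y; exact: le_total.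
have srt := sort_sorted tot t.
have trr : transitive (fun x y : R => y <= x) by move=> x y z h1 h2; exact: le_trans h2 h1.
by apply: (sorted_leq_nth trr (fun x : R => lexx x) 0 srt) => //;
  rewrite inE size_sort size_tuple.
Qed.

Section SingularValues.
Variable R : realType.
Local Notation C := (R[i]).
Local Open Scope sesquilinear_scope.

Lemma conjTE m n (A : 'M[C]_(m, n)) : conjT A = A ^t*.
Proof. by apply/matrixP => i j; rewrite !mxE. Qed.

Lemma unitary_mxE n (U : 'M[C]_n) : unitary_mx U <-> U \is unitarymx.
Proof. by rewrite /unitary_mx conjTE; split=> [H|/unitarymxP//]; apply/unitarymxP. Qed.

(** The left vectors diagonalize the Gram matrix of the rows of [A]; the right ones are the
    normalized nonzero rows of [Q *m A], completed to a unitary matrix. *)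
Lemma svals_exists n1 n2 (A : 'M[C]_(n1, n2)) : exists s, is_svals A s.
Proof.
pose G := A *m A ^t*.
have GG : G ^t* = G by rewrite /G trmxC_mul trmxCK.
have /orthomx_spectralP GE : G \is normalmx by apply/normalmxP; rewrite GG.
set P := spectralmx G in GE; set sp := spectral_diag G in GE.
have uP : P \is unitarymx := spectral_unitarymx G.
have PPt : P *m P ^t* = 1%:M by apply/unitarymxP.
have [s hs] := sort_perm (fun i => complex.Re (sp 0 i)).
pose Q : 'M[C]_n1 := \matrix_(i, j) P (s i) j.
have QE m (M : 'M[C]_(n1, m)) : Q *m M = \matrix_(i, j) (P *m M) (s i) j.
  by apply/matrixP => i j; rewrite !mxE; apply: eq_bigr => k _; rewrite mxE.
have QQ (M : 'M[C]_n1) i j :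
    (Q *m M *m Q ^t*) i j = (P *m M *m P ^t*) (s i) (s j).
  rewrite QE !gram_coef; apply: eq_bigr => k _; congr (_ * _^*); by rewrite mxE.
have uQ : Q \is unitarymx.
  apply/unitarymxP/matrixP => i j; rewrite -[Q in Q *m _]mulmx1 QQ mulmx1 PPt !mxE.
  by rewrite (inj_eq perm_inj).
pose B := Q *m A.
have BB i j : (B *m B ^t*) i j = sp 0 (s i) *+ (i == j).
  have -> : B *m B ^t* = Q *m G *m Q ^t* by rewrite /B /G trmxC_mul !mulmxA.
  rewrite QQ GE (invmx_unitary uP) !mulmxA PPt mul1mx -mulmxA PPt mulmx1 mxE.
  by rewrite (inj_eq perm_inj).
have spE i : sp 0 (s i) = \sum_k `|B i k| ^+ 2.
  have := BB i i; rewrite eqxx mulr1n gram_coef => <-.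
  by apply: eq_bigr => k _; rewrite -normCK.
pose d i := complex.Re (sp 0 (s i)).
have sp_ge0 i : 0 <= sp 0 (s i).
  by rewrite spE; apply: sumr_ge0 => k _; rewrite exprn_ge0.
have spd i : sp 0 (s i) = (d i)%:C%C by rewrite RRe_real// ger0_real.
have d_ge0 i : 0 <= d i by have := sp_ge0 i; rewrite spd ler0c.
have hd (i j : 'I_n1) : (i <= j)%N -> d j <= d i by exact: hs.
(* The eigenvalues are sorted, so the least [p] from which all [d] vanish counts the positive
   ones. *)
pose Z p := [forall i : 'I_n1, (p <= i)%N ==> (d i == 0)].
have exZ : exists p, Z p.
  by exists n1; apply/forallP => i; rewrite leqNgt ltn_ord.
case: (ex_minnP exZ) => p /forallP Zp minp.
have pn1 : (p <= n1)%N by apply: minp; apply/forallP => i; rewrite leqNgt ltn_ord.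
have d0 (i : 'I_n1) : (p <= i)%N -> d i = 0 by move=> pi; apply/eqP/(implyP (Zp i)).
have dpos (i : 'I_n1) : (i < p)%N -> 0 < d i.
  move=> ip; rewrite lt_neqAle d_ge0 andbT eq_sym; apply/negP => /eqP di.
  have := minp i; rewrite leqNgt ip => /(_ _)/negP; case=> //.
  apply/forallP => j; apply/implyP => ij; rewrite eq_le d_ge0 andbT.
  by rewrite -di hd.
pose sq i := Num.sqrt (d i).
have sqC i : (0 < d i) -> (sq i)%:C%C != 0 :> C.
  by move=> di; rewrite (inj_eq (@complexI R)) sqrtr_eq0 -ltNge.
pose B1 : 'M[C]_(p, n2) :=
  \matrix_(i, k) (((sq (widen_ord pn1 i))%:C%C)^-1 * B (widen_ord pn1 i) k).
have uB1 : B1 \is unitarymx.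
  apply/unitarymxP/matrixP => i j; rewrite gram_coef mxE.
  set i' := widen_ord pn1 i; set j' := widen_ord pn1 j.
  transitivity ((((sq i')%:C%C)^-1 * ((sq j')%:C%C)^-1) * (B *m B ^t*) i' j' : C).
    rewrite gram_coef mulr_sumr; apply: eq_bigr => k _; rewrite !mxE rmorphM/=.
    rewrite fmorphV /= -/i' -/j'.
    have -> : Num.conj ((sq j')%:C)%C = ((sq j')%:C)%C by apply: conjc_real.
    by rewrite mulrACA.
  rewrite BB; have -> : (i' == j') = (i == j) by [].
  case: eqP => [ij|_]; last by rewrite mulr0n mulr0.
  have -> : j' = i' by rewrite /j' -ij.
  rewrite mulr1n spd -(sqr_sqrtr (d_ge0 i')) -/(sq i').
  rewrite rmorphXn /= expr2 -invfM mulVf// mulf_neq0// sqC// dpos//=.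
(* Orthonormal rows cannot outnumber the columns, so [p] is at most [rk n1 n2] and [sv] vanishes
   from there on. *)
have pn2 : (p <= n2)%N by rewrite -(mxrank_unitary uB1) rank_leq_col.
have [W uW WB] := unitarymx_completion uB1.
pose sv k := if insub k is Some i then sq i else 0.
have svE (i : 'I_n1) : sv i = sq i by rewrite /sv valK.
have sq0 (i : 'I_n1) : (p <= i)%N -> sq i = 0 by move=> /d0 di; rewrite /sq di sqrtr0.
exists sv; split.
- move=> i j /andP[ij jr]; have jn : (j < n1)%N by rewrite (leq_trans jr)// geq_minl.
  have i_n : (i < n1)%N by rewrite (leq_ltn_trans ij).
  rewrite (svE (Ordinal i_n)) (svE (Ordinal jn)) ler_sqrt ?d_ge0//; exact: hd.
- by move=> i _; rewrite /sv; case: insubP => // *; exact: sqrtr_ge0.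
- move=> i ri; rewrite /sv; case: insubP => //= u _ ui.
  by rewrite sq0// ui (leq_trans _ ri)// leq_min pn1 pn2.
- exists (Q ^t*), (W ^t*); split.
  + by apply/unitary_mxE; rewrite trmxC_unitary.
  + by apply/unitary_mxE; rewrite trmxC_unitary.
  rewrite conjTE trmxCK -mulmxA.
  suff -> : rdiag n1 n2 sv *m W = B.
    rewrite /B mulmxA -(invmx_unitary uQ) mulVmx ?mul1mx//; exact: unitarymx_unit.
  apply/matrixP => i k; rewrite mxE.
  case: (ltnP i p) => ip; last first.
    rewrite big1; last first.
      by move=> j _; rewrite mxE svE sq0//; case: eqP => _; rewrite mul0r.
    have := spE i; rewrite spd d0// => /esym/eqP.
    rewrite psumr_eq0; last by move=> j _; rewrite exprn_ge0.
    by move=> /allP/(_ k); rewrite mem_index_enum expf_eq0/= normr_eq0 => /(_ isT)/eqP->.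
  have i2 : (i < n2)%N by rewrite (leq_trans ip).
  rewrite (bigD1 (Ordinal i2))//= big1 ?addr0; last first.
    move=> j /negP ji; rewrite mxE; case: eqP => [ij|_]; last by rewrite mul0r.
    by case: ji; apply/eqP/val_inj.
  have := WB (Ordinal ip) (Ordinal i2) erefl => /rowP/(_ k); rewrite !mxE => ->.
  have -> : widen_ord pn1 (Ordinal ip) = i by apply: val_inj.
  rewrite eqxx svE mulrA divff ?mul1r//; exact/sqC/dpos.
Qed.
End SingularValues.

(** * Euclidean vectors *)

Section EuclideanVectors.
Variables (R : realType) (I : finType).
Implicit Types u v w : vec R I.

Definition scalev (a : R) u : vec R I := [ffun i => a * u i].

Lemma dotvC u v : dotv u v = dotv v u.
Proof. by apply: eq_bigr => i _; rewrite mulrC. Qed.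

Lemma dotvDl u v w : dotv (u + v) w = dotv u w + dotv v w.
Proof. by rewrite -big_split; apply: eq_bigr => i _; rewrite ffunE mulrDl. Qed.

Lemma dotvNl u v : dotv (- u) v = - dotv u v.
Proof. by rewrite -sumrN; apply: eq_bigr => i _; rewrite ffunE mulNr. Qed.

Lemma dotvZl a u v : dotv (scalev a u) v = a * dotv u v.
Proof. by rewrite mulr_sumr; apply: eq_bigr => i _; rewrite ffunE mulrA. Qed.

Lemma dotv0l v : dotv 0 v = 0.
Proof. by rewrite /dotv big1// => i _; rewrite ffunE mul0r. Qed.

Lemma dotvDr u v w : dotv w (u + v) = dotv w u + dotv w v.
Proof. by rewrite dotvC dotvDl !(dotvC w). Qed.

Lemma dotvNr u v : dotv v (- u) = - dotv v u.
Proof. by rewrite dotvC dotvNl dotvC. Qed.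

Lemma dotvZr a u v : dotv v (scalev a u) = a * dotv v u.
Proof. by rewrite dotvC dotvZl dotvC. Qed.

Definition dotvE := (dotvDl, dotvDr, dotvNl, dotvNr, dotvZl, dotvZr).

Lemma dotvv_ge0 u : 0 <= dotv u u.
Proof. by apply: sumr_ge0 => i _; rewrite -expr2 sqr_ge0. Qed.

Lemma normv_ge0 u : 0 <= normv u.
Proof. exact: sqrtr_ge0. Qed.

Lemma normv_sqr u : normv u ^+ 2 = dotv u u.
Proof. by rewrite sqr_sqrtr// dotvv_ge0. Qed.

Lemma dotvv_eq0 u : dotv u u = 0 -> u = 0.
Proof.
move=> /eqP; rewrite psumr_eq0 => [/allP h|i _]; last by rewrite -expr2 sqr_ge0.
apply/ffunP => i; have := h i; rewrite mem_index_enum => /(_ isT).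
by rewrite mulf_eq0 orbb ffunE => /eqP.
Qed.

Lemma normv_eq0 u : normv u = 0 -> u = 0.
Proof. by move=> u0; apply: dotvv_eq0; rewrite -normv_sqr u0 expr0n. Qed.

Lemma normv0 : normv (0 : vec R I) = 0.
Proof. by rewrite /normv dotv0l sqrtr0. Qed.

Lemma normvN u : normv (- u) = normv u.
Proof. by rewrite /normv !dotvE opprK. Qed.

Lemma normvBC u v : normv (u - v) = normv (v - u).
Proof. by rewrite -normvN opprB. Qed.

Lemma normvZ a u : normv (scalev a u) = `|a| * normv u.
Proof. by rewrite /normv !dotvE mulrA -expr2 sqrtrM ?sqr_ge0// sqrtr_sqr. Qed.

Lemma cauchy_schwarz u v : `|dotv u v| <= normv u * normv v.
Proof.
rewrite -(@ler_pXn2r _ 2)// ?nnegrE ?mulr_ge0 ?normv_ge0//.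
rewrite exprMn !normv_sqr real_normK ?num_real//.
have [v0|v0] := eqVneq (dotv v v) 0.
  by rewrite (dotvv_eq0 v0) dotvC dotv0l dotv0l expr0n mulr0.
have vp : 0 < dotv v v by rewrite lt_neqAle eq_sym v0 dotvv_ge0.
have := dotvv_ge0 (scalev (dotv v v) u - scalev (dotv u v) v).
rewrite !dotvE (dotvC v u) -subr_ge0 -(pmulr_rge0 _ vp).
by congr (0 <= _); ring.
Qed.

Lemma dotv_le u v : dotv u v <= normv u * normv v.
Proof. exact: le_trans (ler_norm _) (cauchy_schwarz u v). Qed.

Lemma dotv_ge u v : - (normv u * normv v) <= dotv u v.
Proof. by rewrite -normvN lerNl -dotvNl dotv_le. Qed.

Lemma ler_normvD u v : normv (u + v) <= normv u + normv v.
Proof.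
rewrite -(@ler_pXn2r _ 2)// ?nnegrE ?addr_ge0 ?normv_ge0//.
rewrite sqrrD !normv_sqr !dotvE (dotvC v u).
by have := dotv_le u v; lra.
Qed.

Lemma ler_normvB u v : normv (u - v) <= normv u + normv v.
Proof. by rewrite -(normvN v) ler_normvD. Qed.

Lemma ler_distvD w u v : normv (u - v) <= normv (u - w) + normv (w - v).
Proof. by rewrite (le_trans _ (ler_normvD _ _))// addrA subrK. Qed.

Lemma normv_sqrD u v :
  normv (u + v) ^+ 2 = normv u ^+ 2 + 2 * dotv u v + normv v ^+ 2.
Proof. by rewrite !normv_sqr !dotvE (dotvC v u); ring. Qed.

Lemma coord_le_normv u i : `|u i| <= normv u.
Proof.
rewrite -(@ler_pXn2r _ 2)// ?nnegrE ?normv_ge0// normv_sqr real_normK ?num_real//.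
rewrite /dotv (bigD1 i)//= expr2 lerDl sumr_ge0// => j _.
by rewrite -expr2 sqr_ge0.
Qed.

Lemma normv_le_sum u : normv u <= \sum_i `|u i|.
Proof.
rewrite -(@ler_pXn2r _ 2)// ?nnegrE ?normv_ge0// ?sumr_ge0//.
rewrite normv_sqr expr2 mulr_suml; apply: ler_sum => i _.
rewrite (le_trans (ler_norm _))// normrM ler_wpM2l//.
by rewrite (bigD1 i)//= lerDl sumr_ge0.
Qed.
End EuclideanVectors.

(** * Weyl's inequality *)

Section WeylInequality.
Variable R : realType.
Local Notation C := (R[i]).
Local Open Scope sesquilinear_scope.

Import ComplexField.Normc.

(** Taking the real norm of the vector of moduli makes the Euclidean lemmas available for complex
    rows. *)
Definition cnorm n (x : 'rV[C]_n) : R := normv [ffun k => normc (x 0 k)].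

Lemma normc_ge0 (z : C) : 0 <= normc z.
Proof. by case: z => a b; exact: sqrtr_ge0. Qed.

Lemma normc_sum (J : Type) (r : seq J) (P : pred J) (F : J -> C) :
  normc (\sum_(j <- r | P j) F j) <= \sum_(j <- r | P j) normc (F j).
Proof.
elim/big_ind2: _ => //; first by rewrite normc0.
by move=> x a y b xa yb; apply: le_trans (lerD xa yb); exact: le_normcD.
Qed.

Lemma cnorm_gram n (x : 'rV[C]_n) : (cnorm x ^+ 2)%:C%C = (x *m x ^t*) 0 0.
Proof.
rewrite gram_coef normv_sqr rmorph_sum; apply: eq_bigr => k _.
by rewrite !ffunE -normCK rmorphM expr2.
Qed.

Lemma cnorm_unitary n (x : 'rV[C]_n) (U : 'M[C]_n) :
  U \is unitarymx -> cnorm (x *m U) = cnorm x.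
Proof.
move=> /unitarymxP uU; apply/eqP.
rewrite -(@eqrXn2 _ 2)// ?normv_ge0//; apply/eqP/(@complexI R).
by rewrite !cnorm_gram trmxC_mul mulmxA -(mulmxA x) uU mulmx1.
Qed.

Lemma cnormD n (x y : 'rV[C]_n) : cnorm (x + y) <= cnorm x + cnorm y.
Proof.
pose u (z : 'rV[C]_n) : vec R 'I_n := [ffun k => normc (z 0 k)].
apply: le_trans (ler_normvD (u x) (u y)).
rewrite -(@ler_pXn2r _ 2)// ?nnegrE ?normv_ge0// !normv_sqr.
apply: ler_sum => k _; rewrite !ffunE mxE -!expr2.
by rewrite ler_pXn2r ?nnegrE ?addr_ge0 ?normc_ge0// le_normcD.
Qed.

Lemma cnorm_mulmx m n (x : 'rV[C]_m) (M : 'M[C]_(m, n)) (K : R) : 0 <= K ->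
  (forall i j, normc (M i j) <= K) -> cnorm (x *m M) <= m%:R * n%:R * K * cnorm x.
Proof.
move=> K0 MK; apply: le_trans (normv_le_sum _) _.
have -> : m%:R * n%:R * K * cnorm x = \sum_(j < n) \sum_(i < m) K * cnorm x.
  by rewrite !sumr_const !card_ord -mulrnA -[RHS]mulr_natl natrM -!mulrA.
apply: ler_sum => k _; rewrite ffunE ger0_norm ?normc_ge0// mxE.
apply: le_trans (normc_sum _ _ _) _.
apply: ler_sum => i _; rewrite normcM mulrC ler_pM ?normc_ge0//.
by have := coord_le_normv [ffun k => normc (x 0 k)] i; rewrite ffunE ger0_norm ?normc_ge0.
Qed.

Lemma cnorm_rdiag n1 n2 (s : nat -> R) (y : 'rV[C]_n1) :
  cnorm (y *m rdiag n1 n2 s) ^+ 2 =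
  \sum_(j < n1 | (j < n2)%N) s j ^+ 2 * normc (y 0 j) ^+ 2.
Proof.
rewrite normv_sqr /dotv.
have E (j : 'I_n2) : (y *m rdiag n1 n2 s) 0 j =
    if insub (j : nat) is Some i then y 0 i * (s j)%:C%C else 0.
  rewrite mxE; case: insubP => [i _ ij|/negP jn].
    rewrite (bigD1 i)//= mxE ij eqxx big1 ?addr0//.
    move=> l li; rewrite mxE; case: eqP => [lj|]; last by rewrite mulr0.
    by move/negP: li; case; apply/eqP/val_inj; rewrite /= ij.
  rewrite big1// => l _; rewrite mxE; case: eqP => [lj|]; last by rewrite mulr0.
  by case: jn; rewrite -lj.
under eq_bigr => j _ do rewrite ffunE E.
rewrite (bigID (fun j : 'I_n2 => (j < n1)%N))/= [X in _ + X]big1 ?addr0; last first.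
  by move=> j /negP jn; case: insubP => // *; rewrite normc0 mulr0.
(* Indexing by [nat] lets the sum move from columns to rows: both ranges are the numbers below
   [minn n1 n2]. *)
pose G (j : nat) := s j ^+ 2 * (if insub j is Some i then normc (y 0 i) ^+ 2 else 0).
transitivity (\sum_(j < n2 | (j < n1)%N) G j).
  apply: eq_bigr => j jn; rewrite /G; case: insubP => [i _ ij|]; last by rewrite jn.
  rewrite normcM -expr2 exprMn mulrC; congr (_ * _).
  by rewrite /normc /= expr0n addr0 sqr_sqrtr ?sqr_ge0.
transitivity (\sum_(j < n1 | (j < n2)%N) G j); last first.
  by apply: eq_bigr => j jn; rewrite /G valK.
have W m p : \sum_(j < m | (j < p)%N) G j = \sum_(j < minn m p) G j.
  rewrite (big_ord_widen_cond m predT G) ?geq_minl//.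
  by apply: eq_bigl => j; rewrite leq_min ltn_ord.
by rewrite !W minnC.
Qed.

(* Courant-Fischer in one step: some nonzero [y *m conjT U] lies in the span of
   the first [i + 1] left singular vectors of [A] and is orthogonal to the
   first [i] left singular vectors of [B]. *)
Lemma weyl n1 n2 (A B : 'M[C]_(n1, n2)) (s s' : nat -> R) (K : R) : 0 <= K ->
  is_svals A s -> is_svals B s' ->
  (forall i j, normc (A i j - B i j) <= K) ->
  forall i, (i < rk n1 n2)%N -> s i <= s' i + n1%:R * n2%:R * K.
Proof.
move=> K0 [sD s0 _ [U [V [/unitary_mxE uU /unitary_mxE uV AE]]]].
move=> [sD' s0' _ [U' [V' [/unitary_mxE uU' /unitary_mxE uV' BE]]]] ABK i ir.
have i1 : (i < n1)%N by rewrite (leq_trans ir)// geq_minl.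
have i2 : (i < n2)%N by rewrite (leq_trans ir)// geq_minr.
have i1' : (i <= n1)%N := ltnW i1.
pose E : 'M[C]_(i.+1, n1) := \matrix_(a, b) (a == b :> nat)%:R.
pose E' : 'M[C]_(n1, i) := \matrix_(a, b) (a == b :> nat)%:R.
pose T := U ^t* *m U'.
(* [T] changes from the left singular basis of [A] to that of [B]; [w] has [i.+1] coordinates and
   only [i] linear equations to satisfy. *)
have [w /sub_kermxP wK w0] : exists2 w : 'rV[C]_i.+1,
    (w <= kermx (E *m T *m E'))%MS & w != 0.
  apply/rowV0Pn; rewrite -mxrank_eq0 mxrank_ker subn_eq0 -ltnNge ltnS.
  exact: rank_leq_col.
pose y := w *m E; pose y' := y *m T; pose x := y *m U ^t*.
have yw (j : 'I_n1) (a : 'I_i.+1) : a = j :> nat -> y 0 j = w 0 a.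
  move=> aj; rewrite mxE (bigD1 a)//= mxE aj eqxx mulr1 big1 ?addr0// => b ba.
  rewrite mxE -aj; case: eqP => [ab|]; last by rewrite mulr0.
  by move/negP: ba; case; apply/eqP/val_inj.
have y_gt (j : 'I_n1) : (i < j)%N -> y 0 j = 0.
  move=> ij; rewrite mxE big1// => a _; rewrite mxE; case: eqP => [aj|]; last by rewrite mulr0.
  by move: ij; rewrite -aj ltnNge -ltnS ltn_ord.
have y'_lt (j : 'I_n1) : (j < i)%N -> y' 0 j = 0.
  have y'E : y' *m E' = 0 by move: wK; rewrite /y' /y /T !mulmxA.
  move=> ji; move/rowP: y'E => /(_ (Ordinal ji)).
  rewrite mxE (bigD1 j)//= [E' _ _]mxE eqxx mulr1 big1 ?addr0 ?[RHS]mxE// => b bj.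
  rewrite [E' _ _]mxE; case: eqP => [bj'|]; last by rewrite mulr0.
  by move/negP: bj; case; apply/eqP/val_inj.
have uUt : U ^t* \is unitarymx by rewrite trmxC_unitary.
have UU : U ^t* *m U = 1%:M.
  by rewrite -(invmx_unitary uU) mulVmx// unitarymx_unit.
have UU' : U' ^t* *m U' = 1%:M.
  by rewrite -(invmx_unitary uU') mulVmx// unitarymx_unit.
have y_pos : 0 < cnorm y.
  rewrite lt_neqAle normv_ge0 andbT eq_sym; apply/negP => /eqP/normv_eq0/ffunP y0.
  move/negP: w0; apply; apply/eqP/rowP => a; rewrite [RHS]mxE.
  have an : (a < n1)%N by rewrite (leq_trans (ltn_ord a)).
  rewrite -(@yw (Ordinal an) a erefl); apply: eq0_normc.
  by have := y0 (Ordinal an); rewrite !ffunE.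
have nx : cnorm x = cnorm y by rewrite cnorm_unitary.
have ny' : cnorm y' = cnorm y by rewrite /y' /T mulmxA cnorm_unitary.
(* [y] lives on indices at most [i], where [s] is at least [s i]; for [B], [y'] lives on indices at
   least [i], where [s'] is at most [s' i]. *)
have xA : s i * cnorm y <= cnorm (x *m A).
  have -> : cnorm (x *m A) = cnorm (y *m rdiag n1 n2 s).
    rewrite AE conjTE /x !mulmxA -(mulmxA y) UU mulmx1 cnorm_unitary//.
    by rewrite trmxC_unitary.
  rewrite -(@ler_pXn2r _ 2)// ?nnegrE ?mulr_ge0 ?normv_ge0 ?s0//.
  rewrite cnorm_rdiag exprMn normv_sqr mulr_sumr big_mkcond/= [X in _ <= X]big_mkcond/=.
  apply: ler_sum => j _; rewrite ffunE -expr2.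
  case: (leqP j i) => ji; last first.
    rewrite y_gt// normc0 expr0n/= !mulr0; by case: ifP.
  rewrite (leq_ltn_trans ji)// ler_wpM2r ?sqr_ge0// ler_pXn2r// ?nnegrE ?s0//.
    by rewrite sD// ji.
  exact: leq_ltn_trans ir.
have xB : cnorm (x *m B) <= s' i * cnorm y.
  have -> : cnorm (x *m B) = cnorm (y' *m rdiag n1 n2 s').
    rewrite BE conjTE /x /y' /T !mulmxA cnorm_unitary//.
    by rewrite trmxC_unitary.
  rewrite -ny' -(@ler_pXn2r _ 2)// ?nnegrE ?mulr_ge0 ?normv_ge0 ?s0'//.
  rewrite cnorm_rdiag exprMn [X in _ <= _ * X]normv_sqr mulr_sumr big_mkcond/=.
  apply: ler_sum => j _; rewrite ffunE -expr2.
  case: ifP => j2; last by rewrite mulr_ge0 ?sqr_ge0.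
  have jr : (j < rk n1 n2)%N by rewrite leq_min ltn_ord j2.
  case: (ltnP j i) => ji; first by rewrite y'_lt// normc0 expr0n/= !mulr0.
  rewrite ler_wpM2r ?sqr_ge0// ler_pXn2r// ?nnegrE ?s0'//.
  by rewrite sD'// ji.
have xAB : cnorm (x *m (A - B)) <= n1%:R * n2%:R * K * cnorm y.
  by rewrite -nx cnorm_mulmx// => a b; rewrite !mxE ABK.
rewrite -(ler_pM2r y_pos) mulrDl (le_trans xA)// -[A](subrK B) mulmxDr.
by rewrite (le_trans (cnormD _ _))// addrC lerD.
Qed.

End WeylInequality.

(** * Lipschitz dependence of the singular values on the tensor *)

Section TensorSingularValues.
Variables (R : realType) (n1 n2 n3 : nat).
Implicit Types X Y : tensor R n1 n2 n3.
Import ComplexField.Normc.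

Lemma sigma_svals X k : is_svals (dft_slice X k) (sigma X k).
Proof. exact: epsilon_spec (svals_exists _). Qed.

Lemma sigma_ge0 X k i : (i < rk n1 n2)%N -> 0 <= sigma X k i.
Proof. by case: (sigma_svals X k) => _ + _ _; apply. Qed.

Lemma normc_omegaX m : normc (omega R n3 ^+ m) = 1.
Proof.
elim: m => [|m IH]; first by rewrite expr0 normc1.
by rewrite exprS normcM IH mulr1 /omega /normc sqrrN cos2Dsin2 sqrtr1.
Qed.

Lemma dft_slice_lip X Y k i j :
  normc (dft_slice X k i j - dft_slice Y k i j) <= n3%:R * normv (X - Y).
Proof.
rewrite !mxE -sumrB; apply: le_trans (normc_sum _ _ _) _.
rewrite -[X in X%:R * _](card_ord n3) -sum1_card natr_sum mulr_suml.
apply: ler_sum => q _; rewrite mul1r -mulrBr normcM normc_omegaX mul1r.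
have := coord_le_normv (X - Y) (i, j, q).
by rewrite !ffunE /normc /= subr0 expr0n addr0 sqrtr_sqr.
Qed.

(** The factor [n1 n2] comes from bounding a matrix by its entries in [weyl], the factor [n3] from
    the DFT sum. *)
Definition sigma_lip : R := n1%:R * n2%:R * n3%:R.

Lemma sigma_lip_ge0 : 0 <= sigma_lip.
Proof. by rewrite !mulr_ge0. Qed.

Lemma sigma_lipschitz X Y k i : (i < rk n1 n2)%N ->
  `|sigma X k i - sigma Y k i| <= sigma_lip * normv (X - Y).
Proof.
move=> ir; have W (Z Z' : tensor R n1 n2 n3) :
    sigma Z k i <= sigma Z' k i + sigma_lip * normv (Z - Z').
  rewrite /sigma_lip -mulrA.
  have K0 : 0 <= n3%:R * normv (Z - Z') by rewrite mulr_ge0 ?normv_ge0.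
  exact: weyl K0 (sigma_svals Z k) (sigma_svals Z' k) (dft_slice_lip Z Z' k) i ir.
rewrite ler_norml; have := W X Y; have := W Y X; rewrite (normvBC Y X); lra.
Qed.
End TensorSingularValues.

(** * Compactness and the descent lemma *)

Section Compactness.
Variables (R : realType) (I : finType).
Import numFieldNormedType.Exports.
Local Open Scope classical_set_scope.

Lemma bounded_cluster (u : nat -> vec R I) (M : R) :
  (forall k, normv (u k) <= M) ->
  exists x : vec R I, forall e : R, 0 < e -> forall N : nat,
    exists2 k : nat, (N <= k)%N & normv (u k - x) < e.
Proof.
move=> uM.
pose v k : 'rV[R]_#|I| := \row_j u k (enum_val j).
have cA := @rV_compact R #|I| (fun _ => `[- M, M]) (fun _ => @segment_compact R (- M) M).
have [|x [_ xc]] := cA (v @ \oo) _ _.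
  exists 0%N => // k _ /= j; rewrite mxE in_itv/= -ler_norml.
  exact: le_trans (coord_le_normv _ _) (uM k).
exists [ffun i => x ord0 (enum_rank i)] => e e0 N.
(* The [+ 1] covers an empty [I] and keeps the sum of [#|I|] coordinate errors strictly below
   [e]. *)
pose e' := e / (#|I|%:R + 1).
have c0 : 0 < #|I|%:R + 1 :> R by rewrite ltr_wpDl.
have e'0 : 0 < e' by rewrite divr_gt0.
have [|w [[k /= Nk <-] [_ xw]]] :=
  xc (v @` [set k | (N <= k)%N]) (ball x e') _ (nbhsx_ballx x e' e'0).
  by exists N => // k /= Nk; exists k.
exists k => //; apply: le_lt_trans (normv_le_sum _) _.
apply: (@le_lt_trans _ _ (\sum_(i : I) e')).
  apply: ler_sum => i _; rewrite !ffunE distrC.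
  by have := xw ord0 (enum_rank i); rewrite mxE enum_rankK => /ltW.
rewrite sumr_const -mulr_natr /e' -mulrA -ltr_pdivlMl// mulVf ?gt_eqF//.
by rewrite mulrC ltr_pdivrMr// mul1r ltrDl.
Qed.

(* Tikhonov regularization makes a lower bounded lsc function coercive. *)
Lemma prox_attained (g : vec R I -> R) (z : vec R I) (m M : R) : 0 < M ->
  Defs.lower_semicontinuous g -> (forall x, m <= g x) ->
  exists x, forall y, g x + M * normv (x - z) ^+ 2 <= g y + M * normv (y - z) ^+ 2.
Proof.
move=> M0 glsc gm; pose G y := g y + M * normv (y - z) ^+ 2.
pose S := [set G y | y in setT].
have Gm y : m <= G y by rewrite (le_trans (gm y))// lerDl mulr_ge0 ?sqr_ge0// ltW.
have Sinf : has_inf S.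
  split; first by exists (G z); exists z.
  by exists m => _ [y _ <-].
pose r k : R := k.+1%:R^-1.
have r1 k : r k <= 1 by rewrite invf_le1// ler1n.
have Sk k : {y | G y < inf S + r k}.
  apply: cid; have [|_ [y _ <-] yl] := @inf_adherent _ S (r k) _ Sinf.
    by rewrite invr_gt0.
  by exists y.
pose u k := projT1 (Sk k); have uS k : G (u k) < inf S + r k := projT2 (Sk k).
have infS y : inf S <= G y by apply: ge_inf; [case: Sinf | exists y].
(* [B - 1] bounds the squared distance from [u k] to [z], hence [B] bounds the distance. *)
pose B := (inf S + 1 - m) / M + 1.
have uB k : normv (u k) <= normv z + B.
  rewrite -{1}(subrK z (u k)) addrC (le_trans (ler_normvD _ _))// lerD2l.
  have h : normv (u k - z) ^+ 2 <= B - 1.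
    rewrite /B addrK ler_pdivlMr// mulrC; have := uS k; have := gm (u k).
    by have := r1 k; rewrite /G; lra.
  have := normv_ge0 (u k - z); nra.
have [x xc] := bounded_cluster uB.
exists x => y; apply: le_trans (infS y); rewrite leNgt; apply/negP => lt.
(* If [x] missed the infimum by [gap], a late term [u k] near [x] would give a contradiction: lower
   semicontinuity, near-minimality and the change of the quadratic each cost at most [gap / 3], the
   first two strictly less. *)
set gap := G x - inf S; have gap0 : 0 < gap by rewrite subr_gt0.
have [d d0 hd] := glsc x (gap / 3) ltac:(by rewrite divr_gt0).
pose a := normv (x - z).
have a0 : 0 <= a := normv_ge0 _.
pose e := Num.min d (gap / (3 * (M * (2 * a + 1)))).
have Ma : 0 < 3 * (M * (2 * a + 1)) by rewrite !mulr_gt0//; lra.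
have e0 : 0 < e by rewrite lt_min d0 divr_gt0.
have [N _ hN] : exists2 N : nat, True & forall k, (N <= k)%N -> r k < gap / 3.
  have g3 : 0 < (gap / 3)^-1 by rewrite invr_gt0 divr_gt0.
  exists (Num.truncn (gap / 3)^-1) => // k Nk.
  rewrite -[X in _ < X]invrK ltf_pV2 ?posrE//.
  rewrite (lt_le_trans (truncnS_gt _))// ler_nat//.
have [k Nk uk] := xc e e0 N.
have ud : normv (u k - x) < d by rewrite (lt_le_trans uk)// ge_min lexx.
have ue : normv (u k - x) * (3 * (M * (2 * a + 1))) <= gap.
  by rewrite -ler_pdivlMr// ltW// (lt_le_trans uk)// ge_min lexx orbT.
have g1 := hd _ ud; have g2 := uS k; have g3 := hN k Nk.
have t1 : a <= normv (u k - x) + normv (u k - z).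
  by rewrite /a (le_trans (ler_distvD (u k) x z))// normvBC.
have b0 := normv_ge0 (u k - z); have c0 := normv_ge0 (u k - x).
have sq : a ^+ 2 - normv (u k - z) ^+ 2 <= normv (u k - x) * (2 * a + 1).
  set b := normv (u k - z) in t1 b0 *; set c := normv (u k - x) in t1 c0 *.
  have ca : 0 <= c * a by rewrite mulr_ge0.
  have [ab|ab] := leP a b.
    have : a ^+ 2 <= b ^+ 2 by rewrite ler_pXn2r ?nnegrE.
    lra.
  have : (a - b) * (a + b) <= c * (a + a) by apply: ler_pM; lra.
  lra.
have : M * (a ^+ 2 - normv (u k - z) ^+ 2) <= gap / 3.
  apply: le_trans (ler_wpM2l (ltW M0) sq) _; lra.
have : gap = G x - inf S by [].
move: g1 g2; rewrite /G -/a; lra.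
Qed.
End Compactness.

(** * Quadratic bounds from a Lipschitz gradient *)

Section DescentLemma.
Variable R : realType.
Import numFieldNormedType.Exports.
Local Open Scope classical_set_scope.

Lemma is_derive_eps_delta (g : R -> R) (s l : R) :
  (forall e, 0 < e -> exists2 d, 0 < d & forall h, `|h| < d ->
     `|g (s + h) - g s - l * h| <= e * `|h|) -> is_derive s (1 : R) g l.
Proof.
move=> gd.
suff cv : h^-1 *: ((g \o shift s) (h *: (1 : R)) - g s) @[h --> 0^'] --> (l : R^o).
  by apply: DeriveDef; [exact: cvgP cv | exact: (cvg_lim _ cv)].
apply/cvgrPdist_le => e e0; have [d d0 hd] := gd e e0.
apply/nbhs_ballP; exists d => //= h; rewrite -ball_normE /= sub0r normrN => hh h0.
have := hd h hh; rewrite /= [h *: 1]mulr1 [h + s]addrC => H.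
have -> : l - h^-1 *: (g (s + h) - g s) = - (h^-1 * (g (s + h) - g s - l * h)).
  by rewrite /GRing.scale /=; field.
by rewrite normrN normrM normfV mulrC ler_pdivrMr ?normr_gt0.
Qed.

(** Subtracting from [f] along the segment its linear part and the quadratic leaves a function whose
    derivative is nonpositive on the unit interval, by Cauchy-Schwarz and the Lipschitz bound; the
    mean value theorem takes the place of an integral. *)
Lemma descent_lemma (I : finType) (f : vec R I -> R) (g : vec R I -> vec R I) (L : R) :
  0 < L -> has_gradient f g ->
  (forall x y, normv (g x - g y) <= L * normv (x - y)) ->
  forall x y, f y <= f x + dotv (g x) (y - x) + L / 2 * normv (y - x) ^+ 2.
Proof.
move=> L0 fg gl x y; set h := y - x.
pose n := normv h; have n0 : 0 <= n := normv_ge0 h.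
pose F s := f (x + scalev s h) - s * dotv (g x) h - L / 2 * s ^+ 2 * n ^+ 2.
pose dF s := dotv (g (x + scalev s h) - g x) h - L * s * n ^+ 2.
have FD s : is_derive s (1 : R) F (dF s).
  apply: is_derive_eps_delta => e e0.
  have n1 : 0 < n + 1 by lra.
  have e1 : 0 < e / 2 / (n + 1) by rewrite !divr_gt0.
  have [d d0 hd] := fg (x + scalev s h) _ e1.
  have Ln : 0 < L * n ^+ 2 + 1 by rewrite ltr_wpDl// mulr_ge0 ?sqr_ge0// ltW.
  exists (Num.min (d / (n + 1)) (e / (L * n ^+ 2 + 1))).
    by rewrite lt_min !divr_gt0.
  move=> t; rewrite lt_min !ltr_pdivlMr// => /andP[t1 t2].
  have tn : normv (scalev t h) < d.
    rewrite normvZ (le_lt_trans _ t1)// ler_wpM2l// -/n; lra.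
  have := hd _ tn; rewrite -(addrA x).
  have -> : scalev s h + scalev t h = scalev (s + t) h.
    by apply/ffunP => i; rewrite !ffunE mulrDl.
  rewrite normvZ dotvZr -/n => H.
  have -> : F (s + t) - F s - dF s * t =
    (f (x + scalev (s + t) h) - f (x + scalev s h) - t * dotv (g (x + scalev s h)) h)
    - L / 2 * n ^+ 2 * t ^+ 2.
    by rewrite /F /dF !dotvE; field.
  rewrite (le_trans (ler_normB _ _))//.
  have -> : e * `|t| = e / 2 * `|t| + e / 2 * `|t| by field.
  apply: lerD.
    apply: (le_trans H).
    have -> : e / 2 / (n + 1) * (`|t| * n) = e / 2 * `|t| * (n / (n + 1)).
      by field; rewrite gt_eqF.
    rewrite ler_piMr ?mulr_ge0 ?invr_ge0 ?(ltW e0)// ler_pdivrMr//; lra.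
  have c0 : 0 <= L / 2 * n ^+ 2 * t ^+ 2.
    by apply: mulr_ge0 (sqr_ge0 t); apply: mulr_ge0 (sqr_ge0 n); lra.
  rewrite ger0_norm//.
  have -> : t ^+ 2 = `|t| * `|t| by rewrite -expr2 real_normK ?num_real.
  rewrite mulrA ler_wpM2r//.
  have nn : 0 <= n ^+ 2 := sqr_ge0 n.
  have tt : 0 <= `|t| by [].
  nra.
have cF : {within `[0, 1], continuous F}.
  by apply: derivable_within_continuous => s _; exact: ex_derive.
have [c] := @MVT_segment R F dF 0 1 ler01 (fun s _ => FD s) cF.
rewrite in_itv/= subr0 mulr1 => /andP[c0 c1] FE.
have : dF c <= 0.
  rewrite /dF subr_le0 (le_trans (dotv_le _ _))// -/n.
  have := gl (x + scalev c h) x; rewrite addrAC subrr add0r normvZ ger0_norm// -/n => H.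
  by rewrite expr2 mulrA ler_wpM2r// -mulrA.
rewrite -FE /F.
have -> : x + scalev 1 h = y.
  by apply/ffunP => i; rewrite !ffunE mul1r addrC subrK.
have -> : x + scalev 0 h = x by apply/ffunP => i; rewrite !ffunE mul0r addr0.
rewrite -/n; lra.
Qed.

Lemma descent_lemma_ge (I : finType) (f : vec R I -> R) (g : vec R I -> vec R I) (L : R) :
  0 < L -> has_gradient f g ->
  (forall x y, normv (g x - g y) <= L * normv (x - y)) ->
  forall x y, f x + dotv (g x) (y - x) - L / 2 * normv (y - x) ^+ 2 <= f y.
Proof.
move=> L0 fg gl x y.
have := @descent_lemma I (fun x => - f x) (fun x => - g x) L L0 _ _ x y.
rewrite dotvNl; move=> H.
suff : - f y <= - f x - dotv (g x) (y - x) + L / 2 * normv (y - x) ^+ 2 by lra.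
apply: H => [z e e0|a b].
  have [d d0 hd] := fg z e e0; exists d => // h hh.
  by have := hd h hh; rewrite -normrN; congr (`|_| <= _); rewrite dotvNl; ring.
by rewrite -opprD normvN gl.
Qed.
End DescentLemma.

(** * The concave penalty *)

Lemma ler_norm_sum_const (R : realType) n (F : 'I_n -> R) (B : R) :
  (forall i, `|F i| <= B) -> `|\sum_(i < n) F i| <= n%:R * B.
Proof.
move=> FB; apply: le_trans (ler_norm_sum _ _ _) _.
apply: (@le_trans _ _ (\sum_(i < n) B)); first exact: ler_sum.
by rewrite sumr_const card_ord mulr_natl.
Qed.

(** Both hypotheses concern the segment from [a] to [b] only, and the derivative is tested at its
    interior points. This one form covers [rho], one-sided at [0], and desingularizing functions,
    whose derivative at [0] may not exist. *)
Lemma concave_tangent (R : realType) (p : R -> R) (a b l : R) :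
  (forall c, 0 <= c <= 1 -> c * p b + (1 - c) * p a <= p (c * b + (1 - c) * a)) ->
  (forall e, 0 < e -> exists2 d, 0 < d & forall c, 0 < c < 1 -> `|c * (b - a)| < d ->
     `|p (a + c * (b - a)) - p a - l * (c * (b - a))| <= e * `|c * (b - a)|) ->
  p b <= p a + l * (b - a).
Proof.
move=> concave deriv; rewrite leNgt; apply/negP => lt.
set gap := p b - p a - l * (b - a).
have gap0 : 0 < gap by rewrite /gap; lra.
have n0 : 0 < `|b - a| + 1 by rewrite ltr_wpDl.
(* With this error rate concavity would bound [c * gap] by [c * gap * |b - a| / (|b - a| + 1)],
   which is smaller. *)
have e0 : 0 < gap / (`|b - a| + 1) by rewrite divr_gt0.
have [d d0 hd] := deriv _ e0.
have D0 : 0 < d + `|b - a| + 1 by have : 0 <= `|b - a| by []; lra.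
pose c := d / (d + `|b - a| + 1).
have c0 : 0 < c by rewrite divr_gt0.
have c1 : c < 1 by rewrite ltr_pdivrMr// mul1r; have : 0 <= `|b - a| by []; lra.
have cE : c * b + (1 - c) * a = a + c * (b - a) by ring.
have nc : `|c * (b - a)| = c * `|b - a| by rewrite normrM (gtr0_norm c0).
have hc : `|c * (b - a)| < d.
  rewrite nc /c mulrAC ltr_pdivrMr// ltr_pM2l//; lra.
have := hd c; rewrite c0 c1 => /(_ isT hc); rewrite ler_norml => /andP[_].
have := concave c; rewrite cE (ltW c0) (ltW c1) => /(_ isT) conc up.
pose q := gap / (`|b - a| + 1).
have gapq : gap = q * (`|b - a| + 1) by rewrite divfK ?gt_eqF.
have cq : 0 < c * q by rewrite mulr_gt0.
have : c * gap <= q * (c * `|b - a|) by rewrite -nc (le_trans _ up)// /gap; lra.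
rewrite gapq; lra.
Qed.

Section ConcavePenalty.
Variables (R : realType) (rho drho : R -> R) (Lg : R).
Hypothesis rho_ge0 : forall t : R, 0 <= t -> 0 <= rho t.
Hypothesis rho_deriv : forall t : R, 0 <= t -> forall e : R, 0 < e ->
  exists2 d : R, 0 < d & forall h : R, 0 <= t + h -> `|h| < d ->
    `|rho (t + h) - rho t - drho t * h| <= e * `|h|.
Hypothesis rho_concave : forall (s t a : R), 0 <= s -> 0 <= t -> 0 <= a <= 1 ->
  a * rho s + (1 - a) * rho t <= rho (a * s + (1 - a) * t).
Hypothesis drho_lip : forall s t : R, 0 <= s -> 0 <= t ->
  `|drho s - drho t| <= Lg * `|s - t|.
Hypothesis drho_pos : forall t : R, 0 <= t -> 0 < drho t.

Lemma rho_tangent a b : 0 <= a -> 0 <= b -> rho b <= rho a + drho a * (b - a).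
Proof.
move=> a0 b0; apply: concave_tangent => [c c01|e e0]; first exact: rho_concave.
have [d d0 hd] := rho_deriv a0 e0; exists d => // c /andP[c0 c1] cd.
apply: hd => //; have -> : a + c * (b - a) = c * b + (1 - c) * a by ring.
by rewrite addr_ge0// mulr_ge0//; lra.
Qed.

Lemma drho_antitone a b : 0 <= a -> a <= b -> drho b <= drho a.
Proof.
move=> a0; rewrite le_eqVlt => /orP[/eqP->//|ab].
have b0 : 0 <= b by lra.
have h1 := rho_tangent a0 b0; have h2 := rho_tangent b0 a0.
have : drho b * (b - a) <= drho a * (b - a) by lra.
by rewrite ler_pM2r// subr_gt0.
Qed.

Lemma drho_le0 a : 0 <= a -> drho a <= drho 0.
Proof. exact: drho_antitone. Qed.

Lemma Lg_ge0 : 0 <= Lg.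
Proof.
have := drho_lip (lexx 0) ler01; rewrite sub0r normrN normr1 mulr1.
exact: le_trans.
Qed.

Lemma rho_lip a b : 0 <= a -> 0 <= b -> `|rho a - rho b| <= drho 0 * `|a - b|.
Proof.
wlog ab : a b / a <= b => [H|a0 b0].
  by case: (leP a b) => [|/ltW] ? ? ?; [exact: H | rewrite distrC (distrC a) H].
have h1 := rho_tangent a0 b0; have h2 := rho_tangent b0 a0.
have da := drho_le0 a0; have db := drho_pos b0.
rewrite !ler0_norm; [|lra|nra].
have : drho a * (b - a) <= drho 0 * (b - a) by rewrite ler_wpM2r// subr_ge0.
lra.
Qed.

(** The tangent at [b], evaluated at [a], has slope [drho b]; replacing it by [drho a] costs the
    quadratic term. *)
Lemma rho_minorant a b : 0 <= a -> 0 <= b ->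
  rho a + drho a * (b - a) - Lg * `|b - a| ^+ 2 <= rho b.
Proof.
move=> a0 b0; have h := rho_tangent b0 a0.
have : `|(drho b - drho a) * (b - a)| <= Lg * `|b - a| ^+ 2.
  by rewrite normrM expr2 mulrA ler_wpM2r// drho_lip.
rewrite ler_norml => /andP[]; lra.
Qed.

(** * Tangent bounds for the nested spectral penalty *)

Section Tensors.
Variables n1 n2 n3 : nat.
Implicit Types X Y W : tensor R n1 n2 n3.
Local Notation r := (rk n1 n2).

Definition slice_pen X (k : 'I_n3) : R := \sum_(i < r) rho (rho (sigma X k i)).
Definition pen X : R := \sum_(k < n3) rho (slice_pen X k).
(** [alphaw] and [betaw] at step [t] are by conversion the weights at [X t]; naming the weights by
    their base tensor allows the base to change. *)
Definition alpha X (k : 'I_n3) : R := drho (slice_pen X k).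
Definition beta X (k : 'I_n3) (i : nat) : R := drho (rho (sigma X k i)).

(* Lipschitz constants of [rho \o sigma], [slice_pen] and the products of the weights. *)
Let c1 : R := drho 0 * sigma_lip R n1 n2 n3.
Let c3 : R := r%:R * (drho 0 * c1).
Let cw : R := drho 0 * (Lg * c3) + drho 0 * (Lg * c1).

Let d0_ge0 : 0 <= drho 0. Proof. exact/ltW/drho_pos. Qed.
Let c1_ge0 : 0 <= c1. Proof. by rewrite mulr_ge0// sigma_lip_ge0. Qed.
Let c3_ge0 : 0 <= c3. Proof. by rewrite mulr_ge0// mulr_ge0. Qed.
Let cw_ge0 : 0 <= cw.
Proof. by rewrite addr_ge0// !mulr_ge0// Lg_ge0. Qed.

Let rs_ge0 X k (i : 'I_r) : 0 <= rho (sigma X k i).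
Proof. exact/rho_ge0/sigma_ge0. Qed.

Let slice_pen_ge0 X k : 0 <= slice_pen X k.
Proof. by apply: sumr_ge0 => i _; exact/rho_ge0. Qed.

Let rs_lip X Y k (i : 'I_r) :
  `|rho (sigma X k i) - rho (sigma Y k i)| <= c1 * normv (X - Y).
Proof.
rewrite (le_trans (rho_lip _ _))// ?sigma_ge0// /c1 -mulrA ler_wpM2l//.
exact: sigma_lipschitz.
Qed.

Let slice_pen_lip X Y k : `|slice_pen X k - slice_pen Y k| <= c3 * normv (X - Y).
Proof.
rewrite /slice_pen -sumrB /c3 -mulrA; apply: ler_norm_sum_const => i.
by rewrite (le_trans (rho_lip _ _))// -mulrA ler_wpM2l.
Qed.

Lemma pen_lip : exists2 c, 0 <= c & forall X Y, `|pen X - pen Y| <= c * normv (X - Y).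
Proof.
exists (n3%:R * (drho 0 * c3)); first by rewrite !mulr_ge0.
move=> X Y; rewrite /pen -sumrB -mulrA; apply: ler_norm_sum_const => k.
by rewrite (le_trans (rho_lip _ _))// -mulrA ler_wpM2l.
Qed.

Lemma wnorm_diff X W Y : wnorm rho (alpha X) (beta X) W - wnorm rho (alpha X) (beta X) Y =
  \sum_(k < n3) alpha X k * \sum_(i < r) beta X k i * (rho (sigma W k i) - rho (sigma Y k i)).
Proof.
rewrite /wnorm -sumrB; apply: eq_bigr => k _; rewrite -sumrB mulr_sumr.
by apply: eq_bigr => i _; rewrite -mulrBr mulrA.
Qed.

(** Tangents of the outer and middle [rho] compose because the outer slope is positive; the
    innermost [rho] is left as it is, which gives exactly the weighted function. *)
Lemma pen_majorant X W :
  pen W <= pen X + (wnorm rho (alpha X) (beta X) W - wnorm rho (alpha X) (beta X) X).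
Proof.
rewrite wnorm_diff -big_split; apply: ler_sum => k _ /=.
apply: le_trans (rho_tangent (slice_pen_ge0 X k) (slice_pen_ge0 W k)) _.
rewrite lerD2l ler_wpM2l ?(ltW (drho_pos _))// /slice_pen -sumrB.
apply: ler_sum => i _.
have := rho_tangent (rs_ge0 X k i) (rs_ge0 W k i); rewrite /beta; lra.
Qed.

(** The same two layers from below: the losses are quadratic because [slice_pen] and
    [rho (sigma X k i)] are Lipschitz in the tensor, and the outer weight is at most [drho 0]. *)
Lemma pen_minorant : exists2 K, 0 <= K & forall X W,
  pen X + (wnorm rho (alpha X) (beta X) W - wnorm rho (alpha X) (beta X) X)
    - K * normv (W - X) ^+ 2 <= pen W.
Proof.
pose K1 := r%:R * (Lg * c1 ^+ 2).
have K1_ge0 : 0 <= K1 by rewrite !mulr_ge0 ?Lg_ge0 ?sqr_ge0.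
exists (n3%:R * (Lg * c3 ^+ 2 + drho 0 * K1)).
  by rewrite mulr_ge0// addr_ge0 ?mulr_ge0 ?Lg_ge0 ?sqr_ge0.
move=> X W; set n := normv (W - X); have n_ge0 : 0 <= n := normv_ge0 _.
rewrite wnorm_diff -big_split /= -[n3 in n3%:R](card_ord n3) -sum1_card natr_sum.
rewrite !mulr_suml -sumrB; apply: ler_sum => k _ /=; rewrite mul1r.
apply: le_trans (rho_minorant (slice_pen_ge0 X k) (slice_pen_ge0 W k)).
rewrite -!addrA lerD2l -/(alpha X k).
have h1 : `|slice_pen W k - slice_pen X k| ^+ 2 <= c3 ^+ 2 * n ^+ 2.
  rewrite -exprMn ler_pXn2r ?nnegrE ?mulr_ge0//; exact: slice_pen_lip.
set T := \sum_(i < r) _.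
have h2 : T - K1 * n ^+ 2 <= slice_pen W k - slice_pen X k.
  rewrite /T /K1 /slice_pen -[r in r%:R](card_ord r) -sum1_card natr_sum.
  rewrite !mulr_suml -!sumrB; apply: ler_sum => i _; rewrite mul1r.
  have := rho_minorant (rs_ge0 X k i) (rs_ge0 W k i); rewrite -/(beta X k i).
  have : `|rho (sigma W k i) - rho (sigma X k i)| ^+ 2 <= c1 ^+ 2 * n ^+ 2.
    by rewrite -exprMn ler_pXn2r ?nnegrE ?mulr_ge0//; exact: rs_lip.
  move/(ler_wpM2l Lg_ge0); lra.
have a0 : 0 <= alpha X k by exact/ltW/drho_pos.
have a1 : alpha X k <= drho 0 by exact: drho_le0.
have h3 := ler_wpM2l a0 h2; have h4 := ler_wpM2l Lg_ge0 h1.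
have h5 : alpha X k * (K1 * n ^+ 2) <= drho 0 * (K1 * n ^+ 2).
  by rewrite ler_wpM2r// mulr_ge0 ?sqr_ge0.
lra.
Qed.

(** The base tensor enters through products of two bounded Lipschitz weights, and each increment of
    [rho (sigma _ k i)] is itself of order [normv (W - Y)]; hence a product of two distances. *)
Lemma wnorm_perturb : exists2 c, 0 <= c & forall X Y W,
  wnorm rho (alpha X) (beta X) W - wnorm rho (alpha X) (beta X) Y
    - c * normv (X - Y) * normv (W - Y)
  <= wnorm rho (alpha Y) (beta Y) W - wnorm rho (alpha Y) (beta Y) Y.
Proof.
exists (n3%:R * (r%:R * (cw * c1))); first by rewrite !mulr_ge0.
move=> X Y W.
suff : `|(wnorm rho (alpha X) (beta X) W - wnorm rho (alpha X) (beta X) Y) -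
   (wnorm rho (alpha Y) (beta Y) W - wnorm rho (alpha Y) (beta Y) Y)|
   <= n3%:R * (r%:R * (cw * c1)) * normv (X - Y) * normv (W - Y).
  by rewrite ler_norml => /andP[_]; lra.
rewrite !wnorm_diff -sumrB -!mulrA; apply: ler_norm_sum_const => k.
rewrite !mulr_sumr -sumrB; apply: ler_norm_sum_const => i.
rewrite mulrA [in X in `|_ - X|]mulrA -mulrBl normrM.
rewrite [leRHS](_ : _ = (cw * normv (X - Y)) * (c1 * normv (W - Y))); last first.
  by rewrite /c1 /sigma_lip; ring.
apply: ler_pM => //.
have ax : alpha X k <= drho 0 by exact: drho_le0.
have ax0 : 0 <= alpha X k by exact/ltW/drho_pos.
have bx : beta Y k i <= drho 0 by exact: drho_le0.
have bx0 : 0 <= beta Y k i by exact/ltW/drho_pos.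
have -> : alpha X k * beta X k i - alpha Y k * beta Y k i =
  alpha X k * (beta X k i - beta Y k i) + beta Y k i * (alpha X k - alpha Y k) by ring.
have hA : `|alpha X k - alpha Y k| <= Lg * (c3 * normv (X - Y)).
  by apply: le_trans (drho_lip _ _) _ => //; rewrite ler_wpM2l ?Lg_ge0.
have hB : `|beta X k i - beta Y k i| <= Lg * (c1 * normv (X - Y)).
  by apply: le_trans (drho_lip _ _) _ => //; rewrite ler_wpM2l ?Lg_ge0.
rewrite (le_trans (ler_normD _ _))// /cw mulrDl addrC !normrM.
rewrite (ger0_norm ax0) (ger0_norm bx0).
apply: lerD; [rewrite -(mulrA (drho 0)) -(mulrA Lg) | rewrite -(mulrA (drho 0)) -(mulrA Lg)];
  exact: ler_pM.
Qed.
End Tensors.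
End ConcavePenalty.

(** * Subgradients and the Kurdyka-Lojasiewicz inequality *)

Section Subgradients.
Variables (R : realType) (I : finType).
Implicit Types (g : vec R I -> R) (x z v : vec R I).

Lemma frechet_limiting g x v : frechet_subdiff g x v -> limiting_subdiff g x v.
Proof.
move=> gv; exists (fun _ => x), (fun _ => v); split=> //.
- by move=> e e0; exists 0%N => k _; rewrite subrr normv0.
- by move=> e e0; exists 0%N => k _; rewrite subrr normr0.
- by move=> e e0; exists 0%N => k _; rewrite subrr normv0.
Qed.

Lemma quadratic_minorant_frechet g x v (K : R) : 0 <= K ->
  (forall y, g x + dotv v (y - x) - K * normv (y - x) ^+ 2 <= g y) ->
  frechet_subdiff g x v.
Proof.
move=> K0 H e e0; have K1 : 0 < K + 1 by lra.
exists (e / (K + 1)); first by rewrite divr_gt0.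
move=> y; rewrite ltr_pdivlMr// => yd; have := H y.
set n := normv (y - x) in yd *; have n0 : 0 <= n := normv_ge0 _.
have : n * (n * (K + 1)) <= n * e by rewrite ler_wpM2l// ltW.
by have : 0 <= n ^+ 2 := sqr_ge0 n; lra.
Qed.

(* The subgradients are produced by proximal points of [g] at [z] with a large
   quadratic penalty, so no calculus rule for the subdifferential is needed. *)
Lemma slope_subgradients g z (m c K : R) :
  Defs.lower_semicontinuous g -> (forall x, m <= g x) -> 0 <= c -> 0 <= K ->
  (forall w, g z - c * normv (w - z) - K * normv (w - z) ^+ 2 <= g w) ->
  forall e, 0 < e -> exists x v,
    [/\ normv (x - z) < e, g z - e < g x <= g z, frechet_subdiff g x v &
        normv v <= 4 * c].
Proof.
move=> glsc gm c0 K0 slope e e0.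
(* Comparison with [z] gives [r * (K + N) <= c] for the proximal distance [r]. The summand [c] of
   [N] then makes [r <= 1], and [q] makes [r * (c + K + 1) < e], which controls both [x] and [g x].
   The summand [2 * K] of [M] beats the quadratic loss and still leaves [2 * M * r <= 4 * c]. *)
pose q := c * (c + K + 1) / e.
have q0 : 0 <= q by rewrite divr_ge0 ?(ltW e0)// mulr_ge0//; lra.
pose N := 1 + c + q; pose M := 2 * K + N.
have N1 : 1 <= N by rewrite /N; lra.
have M0 : 0 < M by rewrite /M; lra.
have [x xmin] := prox_attained z M0 glsc gm.
have := xmin z; rewrite subrr normv0 expr0n/= mulr0 addr0.
set r := normv (x - z) => xz; have r0 : 0 <= r := normv_ge0 _.
have sl := slope x; rewrite -/r in sl.
have rN : r * (K + N) <= c.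
  have : r * (r * (K + N)) <= r * c by move: xz sl; rewrite /M; lra.
  have [->|rn0] := eqVneq r 0; first by move=> _; rewrite mul0r.
  by rewrite ler_pM2l// lt_neqAle eq_sym rn0.
have KN : 0 < K + N by lra.
have rc : r * N <= c by have : 0 <= r * K := mulr_ge0 r0 K0; lra.
have r1 : r <= 1.
  have rq : 0 <= r * q by rewrite mulr_ge0.
  move: rc; rewrite /N; nra.
have re : r * (c + K + 1) < e.
  have qe : c * (c + K + 1) = q * e by rewrite /q divfK ?gt_eqF.
  have w0 : 0 < c + K + 1 by lra.
  have h1 : r * N * (c + K + 1) <= q * e by rewrite -qe ler_wpM2r// ltW.
  rewrite ltNge; apply/negP => h2.
  have : N * e <= q * e by apply: le_trans h1; rewrite (mulrC r) -mulrA ler_wpM2l//; lra.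
  rewrite ler_pM2r// /N; lra.
exists x, (scalev (- (2 * M)) (x - z)); split.
- by apply: le_lt_trans re; rewrite -/r ler_peMr//; lra.
- have Kr : 0 <= r * K by rewrite mulr_ge0.
  have Mr : 0 <= M * r ^+ 2 by rewrite mulr_ge0 ?sqr_ge0// ltW.
  have r2 : K * r ^+ 2 <= K * r by rewrite ler_wpM2l// expr2 ler_piMr.
  by apply/andP; split; lra.
- apply: (@quadratic_minorant_frechet _ _ _ M (ltW M0)) => y.
  have := xmin y; rewrite dotvZl (dotvC (x - z)).
  have -> : y - z = (y - x) + (x - z) by rewrite addrA subrK.
  by rewrite (normv_sqrD (y - x)); lra.
- rewrite normvZ normrN ger0_norm; last by rewrite mulr_ge0// ltW.
  rewrite -/r /M; have : 0 <= r * N by rewrite mulr_ge0//; lra.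
  have : 0 <= r * K by rewrite mulr_ge0.
  lra.
Qed.

(** If the product were below [1], continuity of [dphi] would keep it below [1] at the nearby points
    of [slope_subgradients], contradicting the KL inequality there. *)
Lemma KL_slope g xb z (m c K eta r : R) (dphi : R -> R) :
  Defs.lower_semicontinuous g -> (forall x, m <= g x) -> 0 <= c -> 0 <= K ->
  (forall s, 0 < s < eta -> forall e : R, 0 < e -> exists2 d : R, 0 < d &
     forall t, 0 < t < eta -> `|t - s| < d -> `|dphi t - dphi s| < e) ->
  (forall s, 0 < s < eta -> 0 < dphi s) ->
  (forall x, normv (x - xb) < r -> g xb < g x < g xb + eta ->
     forall v, limiting_subdiff g x v -> 1 <= dphi (g x - g xb) * normv v) ->
  (forall w, g z - c * normv (w - z) - K * normv (w - z) ^+ 2 <= g w) ->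
  normv (z - xb) < r -> g xb < g z < g xb + eta ->
  1 <= dphi (g z - g xb) * (4 * c).
Proof.
move=> glsc gm c0 K0 dcont dpos KL slope zr /andP[gz1 gz2].
set s := g z - g xb; have s01 : 0 < s < eta by rewrite /s; apply/andP; split; lra.
rewrite leNgt; apply/negP => lt.
(* This choice turns [(dphi s + e1) * (4 * c)] into [1 - e1]. *)
pose e1 := (1 - dphi s * (4 * c)) / (4 * c + 1).
have c4 : 0 < 4 * c + 1 by lra.
have e10 : 0 < e1 by rewrite divr_gt0// subr_gt0.
have e1E : e1 * (4 * c + 1) = 1 - dphi s * (4 * c) by rewrite divfK ?gt_eqF.
have [d d0 hd] := dcont s s01 e1 e10.
(* The three bounds keep [x] in the KL ball, [g x - g xb] where [dphi] is controlled, and [g x]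
   above [g xb]. *)
pose e := Num.min (r - normv (z - xb)) (Num.min d s).
have e0 : 0 < e by rewrite !lt_min subr_gt0 zr d0; case/andP: s01.
have [x [v [xz /andP[gx1 gx2] xv vc]]] := slope_subgradients glsc gm c0 K0 slope e0.
move: xz gx1; rewrite lt_min => /andP[xz _] gx1.
have ed : e <= d by rewrite /e ge_min ge_min lexx/= orbT.
have es : e <= s by rewrite /e !ge_min lexx !orbT.
have xr : normv (x - xb) < r.
  by apply: le_lt_trans (ler_distvD z _ _) _; lra.
have gxb : g xb < g x by move: es; rewrite /s; lra.
have gxe : g x < g xb + eta by lra.
have := KL x xr; rewrite gxb gxe => /(_ isT v (frechet_limiting xv)).
have sx : 0 < g x - g xb < eta by apply/andP; split; lra.
have xs : `|g x - g xb - s| < d by rewrite /s ltr_norml; apply/andP; split; lra.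
have := hd _ sx xs; rewrite ltr_norml => /andP[_ dx]; have := dpos _ sx => dx0 H.
have : dphi (g x - g xb) * normv v <= (dphi s + e1) * (4 * c).
  apply: ler_pM => //; [exact: ltW | exact: normv_ge0 | lra].
by rewrite mulrDl; lra.
Qed.
End Subgradients.

(** * Finite length and convergence from sufficient decrease and a KL inequality *)

Section KLSequence.
Variables (R : realType) (I : finType) (X : nat -> vec R I) (Xs : vec R I).
Variables (h : nat -> R) (hs a b eta r : R) (phi dphi : R -> R).
Let D t := normv (X t.+1 - X t).
Hypothesis a_gt0 : 0 < a.
Hypothesis b_gt0 : 0 < b.
Hypothesis eta_gt0 : 0 < eta.
Hypothesis r_gt0 : 0 < r.
Hypothesis h_decr : forall t, h t.+1 <= h t - a * normv (X t.+1 - X t) ^+ 2.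
Hypothesis h_ge : forall t, hs <= h t.
Hypothesis h_cvg : forall e, 0 < e -> exists N, forall t, (N <= t)%N -> h t < hs + e.
Hypothesis X_cluster : forall e, 0 < e -> forall N,
  exists2 t, (N <= t)%N & normv (X t.+2 - Xs) < e.
Hypothesis phi_ge0 : forall s, 0 <= s < eta -> 0 <= phi s.
Hypothesis phi_cont0 : forall e, 0 < e -> exists2 d : R, 0 < d &
  forall t, 0 <= t < eta -> `|t| < d -> phi t < e.
Hypothesis phi_tangent : forall s t, 0 < s < eta -> 0 <= t < eta ->
  phi t <= phi s + dphi s * (t - s).
Hypothesis dphi_gt0 : forall s, 0 < s < eta -> 0 < dphi s.
Hypothesis slope : forall t, normv (X t.+2 - Xs) < r -> normv (X t.+1 - Xs) < r ->
  hs < h t.+2 < hs + eta ->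
  1 <= dphi (h t.+2 - hs) *
       (b * (normv (X t.+2 - X t.+1) + normv (X t.+1 - X t))).

Let B := b / a.
(** The weights [1 / 2] and [1 / 4] spread the term [(D t.+1 + D t) / 4] of the step bound over two
    indices, leaving a gain of [D t.+2 / 2] per step. *)
Let P t := B * phi (h t.+2 - hs) + D t.+1 / 2 + D t / 4.

Let D_ge0 t : 0 <= D t. Proof. exact: normv_ge0. Qed.
Let B_gt0 : 0 < B. Proof. exact: divr_gt0. Qed.

Let h_anti t : h t.+1 <= h t.
Proof.
by have := h_decr t; have : 0 <= a * D t ^+ 2; [rewrite mulr_ge0 ?sqr_ge0// ltW|rewrite /D; lra].
Qed.

Let phi_step t : h t.+2 < hs + eta -> 0 <= phi (h t.+2 - hs).
Proof. by move=> he; apply: phi_ge0; have := h_ge t.+2; move=> ?; apply/andP; split; lra. Qed.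

(* AM-GM turns [a D_t^2 <= b (D_(t-1) + D_(t-2)) (phi_t - phi_(t+1))] into a linear
   inequality, which is what makes the potential [P] decrease. *)
Let P_decr t : normv (X t.+2 - Xs) < r -> normv (X t.+1 - Xs) < r ->
  h t.+2 < hs + eta -> P t.+1 + D t.+2 / 2 <= P t.
Proof.
move=> x2 x1 he.
suff : D t.+2 <= B * (phi (h t.+2 - hs) - phi (h t.+3 - hs)) + (D t.+1 + D t) / 4.
  by rewrite /P; lra.
have hd : h t.+3 <= h t.+2 - a * D t.+2 ^+ 2 := h_decr t.+2.
have h3 := h_ge t.+3; have h2 := h_ge t.+2.
have E0 : 0 <= D t.+1 + D t by rewrite addr_ge0.
(* At the limit value the KL inequality is silent, but the decrease of [h] forces a zero step. *)
have [heq|hne] := eqVneq (h t.+2) hs.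
  have aD : 0 <= a * D t.+2 ^+ 2 by rewrite mulr_ge0 ?sqr_ge0// ltW.
  have h3e : h t.+3 = hs by lra.
  have : a * D t.+2 ^+ 2 = 0 by lra.
  move/eqP; rewrite mulf_eq0 (gt_eqF a_gt0)/= expf_eq0/= => /eqP->.
  by rewrite heq h3e subrr mulr0 add0r; lra.
have hlt : hs < h t.+2 by rewrite lt_neqAle eq_sym hne.
have s01 : 0 < h t.+2 - hs < eta by apply/andP; split; lra.
have t01 : 0 <= h t.+3 - hs < eta.
  by have := h_anti t.+2; move=> ?; apply/andP; split; lra.
have := @slope t x2 x1; rewrite hlt he => /(_ isT); rewrite -/(D _) -/(D _).
have := phi_tangent s01 t01; have := dphi_gt0 s01.
set p := phi (h t.+2 - hs); set p' := phi (h t.+3 - hs); set dp := dphi _.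
set E := D t.+1 + D t in E0 *; set d := D t.+2 in hd *.
have d0 : 0 <= d := D_ge0 _.
move=> dp0 tan sl.
have pd : dp * (a * d ^+ 2) <= p - p'.
  have : dp * (a * d ^+ 2) <= dp * (h t.+2 - h t.+3) by rewrite ler_pM2l//; lra.
  lra.
have pp : 0 <= p - p' by apply: le_trans pd; rewrite !mulr_ge0 ?sqr_ge0// ltW.
pose u := B * (p - p'); have u0 : 0 <= u by rewrite mulr_ge0// ltW.
have key : d ^+ 2 <= u * E.
  have h1 : a * d ^+ 2 <= (dp * (b * E)) * (a * d ^+ 2).
    by rewrite ler_peMl// mulr_ge0 ?sqr_ge0// ltW.
  have h4 : b * E * (dp * (a * d ^+ 2)) <= b * E * (p - p').
    by rewrite ler_wpM2l// mulr_ge0// ltW.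
  rewrite -(ler_pM2l a_gt0) /u /B.
  have -> : a * (b / a * (p - p') * E) = b * E * (p - p').
    by field; rewrite gt_eqF.
  lra.
(* A step above [u + E / 4] would violate [d ^+ 2 <= u * E], since [u * E <= (u + E / 4) ^+ 2]. *)
rewrite -/u leNgt; apply/negP => lt.
have : (u + E / 4) ^+ 2 < d ^+ 2.
  by rewrite ltr_pXn2r ?nnegrE//; apply: addr_ge0 => //; lra.
have := sqr_ge0 (u - E / 4); lra.
Qed.

(** The invariant that keeps the path in the KL ball: for [h t.+2 < hs + eta] it dominates the
    distances of [X t.+2] and [X t.+1] to [Xs], and within the ball a step of length [D t.+2] is
    paid for by the decrease of [2 * P]. *)
Let Q t := normv (X t.+2 - Xs) + 2 * P t.

Let Dto0 e : 0 < e -> exists N, forall t, (N <= t)%N -> D t < e.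
Proof.
move=> e0; have ae : 0 < a * e ^+ 2 by rewrite mulr_gt0// exprn_gt0.
have [N hN] := h_cvg ae; exists N => t Nt.
rewrite ltNge; apply/negP => eD.
have := hN t Nt; have := h_ge t.+1; have := h_decr t; rewrite -/(D t).
have : a * e ^+ 2 <= a * D t ^+ 2.
  by rewrite ler_pM2l// ler_pXn2r ?nnegrE// ltW.
lra.
Qed.

Let start e : 0 < e -> exists t, h t.+2 < hs + eta /\ Q t < e.
Proof.
move=> e0.
have e1 : 0 < e / 8 / B by rewrite !divr_gt0.
have [d d0 hd] := phi_cont0 e1.
have e2 : 0 < Num.min eta d by rewrite lt_min eta_gt0.
have [N1 hN1] := h_cvg e2.
have e8 : 0 < e / 8 by rewrite divr_gt0.
have [N2 hN2] := Dto0 e8.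
have [t Nt xt] := X_cluster e8 (maxn N1 N2).
move: Nt; rewrite geq_max => /andP[t1 t2].
have ht := hN1 t.+2 (leq_trans t1 (leqW (leqnSn t))).
have ht1 : h t.+2 < hs + eta by apply: lt_le_trans ht _; rewrite lerD2l ge_min lexx.
have ht2 : h t.+2 < hs + d by apply: lt_le_trans ht _; rewrite lerD2l ge_min lexx orbT.
have hg := h_ge t.+2.
exists t; split=> //; rewrite /Q /P.
have D1 := hN2 t.+1 (leqW t2); have D2 := hN2 t t2.
have ph : phi (h t.+2 - hs) < e / 8 / B.
  apply: hd; first by apply/andP; split; lra.
  by rewrite ger0_norm; lra.
have : B * phi (h t.+2 - hs) < e / 8 by rewrite mulrC -ltr_pdivlMr.
lra.
Qed.

Let P_ge t : h t.+2 < hs + eta -> D t.+1 / 2 <= P t.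
Proof.
move=> /phi_step p0; rewrite /P; have := D_ge0 t.
have : 0 <= B * phi (h t.+2 - hs) by rewrite mulr_ge0// ltW.
lra.
Qed.

Let Q_step t : h t.+2 < hs + eta -> Q t < r ->
  [/\ h t.+3 < hs + eta, Q t.+1 <= Q t & D t.+2 + 2 * P t.+1 <= 2 * P t].
Proof.
move=> he Qr; have Pt := P_ge he; have D1 := D_ge0 t.+1.
have x2 : normv (X t.+2 - Xs) < r by move: Qr; rewrite /Q; lra.
have x1 : normv (X t.+1 - Xs) < r.
  apply: le_lt_trans (ler_distvD (X t.+2) _ _) _; rewrite normvBC.
  by move: Qr; rewrite /Q -/(D t.+1); lra.
have := P_decr x2 x1 he => Pd; split; last by lra.
  exact: le_lt_trans (h_anti _) he.
rewrite /Q; have := ler_distvD (X t.+2) (X t.+3) Xs; rewrite -/(D t.+2); lra.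
Qed.

Let Q_iter t k : h t.+2 < hs + eta -> Q t < r ->
  [/\ h (t + k).+2 < hs + eta, Q (t + k) <= Q t &
      \sum_(j < k) D (t + j).+2 + 2 * P (t + k) <= 2 * P t].
Proof.
move=> he Qr; elim: k => [|k [h1 h2 h3]].
  by rewrite addn0 big_ord0 add0r.
have [g1 g2 g3] := Q_step h1 (le_lt_trans h2 Qr).
rewrite addnS; split=> //; first exact: le_trans g2 h2.
by rewrite big_ord_recr/=; lra.
Qed.

(** [Q] can be started below any positive bound and, once below [r], never exceeds its starting
    value. *)
Lemma KL_sequence_cvg : cvgv X Xs.
Proof.
move=> e e0; have m0 : 0 < Num.min e r by rewrite lt_min e0.
have [t [he]] := start m0; rewrite lt_min => /andP[Qe Qr].
exists t.+2 => k; move=> tk; have [j ->] : exists j, k = (t + j).+2.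
  by exists (k - t.+2)%N; rewrite -!addSn subnKC.
have [h1 h2 h3] := Q_iter j he Qr.
apply: le_lt_trans Qe; apply: le_trans h2; rewrite /Q.
by have := P_ge h1; have := D_ge0 (t + j).+1; lra.
Qed.

Lemma KL_sequence_length :
  exists C, forall N, \sum_(t < N) normv (X t.+1 - X t) <= C.
Proof.
have [t [he Qr]] := start r_gt0.
exists (\sum_(i < t.+2) D i + 2 * P t) => N.
have [h1 h2 h3] := Q_iter N he Qr.
apply: (@le_trans _ _ (\sum_(i < t.+2 + N) D i)).
  rewrite addnC big_split_ord/= lerDl; apply: sumr_ge0 => i _; exact: D_ge0.
rewrite big_split_ord/= lerD2l.
have := P_ge h1; have := D_ge0 (t + N).+1; move: h3.
by under [in X in _ -> _ -> _ -> X <= _]eq_bigr => i _ do rewrite addSn addSn; lra.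
Qed.
End KLSequence.

(** * The TNNR iteration *)

(** Once [h] is within [a * e ^+ 2] of its infimum, a step of size [e] would push it below. *)
Lemma sqr_summand_cvg0 (R : realType) (h D : nat -> R) (a m : R) : 0 < a ->
  (forall t, 0 <= D t) -> (forall t, m <= h t) ->
  (forall t, h t.+1 <= h t - a * D t ^+ 2) ->
  forall e, 0 < e -> exists N, forall t, (N <= t)%N -> D t < e.
Proof.
move=> a0 D0 hm hd e e0; pose S := [set h t | t in setT]%classic.
have Sinf : has_inf S.
  split; first by exists (h 0%N); exists 0%N.
  by exists m => _ [t _ <-].
have ae : 0 < a * e ^+ 2 by rewrite mulr_gt0// exprn_gt0.
have [_ [N _ <-] hN] := inf_adherent ae Sinf.
exists N => t Nt; rewrite ltNge; apply/negP => eD.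
have hle k : h (N + k)%N <= h N.
  elim: k => [|k IH]; first by rewrite addn0.
  rewrite addnS; have := hd (N + k)%N.
  have : 0 <= a * D (N + k)%N ^+ 2 by rewrite mulr_ge0 ?sqr_ge0// ltW.
  lra.
have := hle (t - N)%N; rewrite subnKC// => htN.
have : inf S <= h t.+1 by apply: ge_inf; [case: Sinf | exists t.+1].
have : a * e ^+ 2 <= a * D t ^+ 2.
  by rewrite ler_pM2l// ler_pXn2r ?nnegrE// ltW.
have := hd t; lra.
Qed.

(** * Pairs of tensors as Euclidean vectors *)

Section Pairs.
Variables (R : realType) (n1 n2 n3 : nat).
Local Notation T := (tensor R n1 n2 n3).
Local Notation TT := (vec R (tidx n1 n2 n3 + tidx n1 n2 n3)%type).

Definition pairv (X Y : T) : TT :=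
  [ffun s => match s with inl i => X i | inr i => Y i end].

Lemma pfst_pairv (X Y : T) : pfst (pairv X Y) = X.
Proof. by apply/ffunP => i; rewrite !ffunE. Qed.

Lemma psnd_pairv (X Y : T) : psnd (pairv X Y) = Y.
Proof. by apply/ffunP => i; rewrite !ffunE. Qed.

Lemma pfstB (Z Z' : TT) : pfst (Z - Z') = pfst Z - pfst Z'.
Proof. by apply/ffunP => i; rewrite !ffunE. Qed.

Lemma psndB (Z Z' : TT) : psnd (Z - Z') = psnd Z - psnd Z'.
Proof. by apply/ffunP => i; rewrite !ffunE. Qed.

Lemma normv_pair_sqr (Z : TT) :
  normv Z ^+ 2 = normv (pfst Z) ^+ 2 + normv (psnd Z) ^+ 2.
Proof.
rewrite !normv_sqr /dotv big_sumType/=.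
by congr (_ + _); apply: eq_bigr => i _; rewrite ffunE.
Qed.

Lemma normv_pfst (Z : TT) : normv (pfst Z) <= normv Z.
Proof.
rewrite -(@ler_pXn2r _ 2)// ?nnegrE ?normv_ge0// normv_pair_sqr lerDl.
exact: sqr_ge0.
Qed.

Lemma normv_psnd (Z : TT) : normv (psnd Z) <= normv Z.
Proof.
rewrite -(@ler_pXn2r _ 2)// ?nnegrE ?normv_ge0// normv_pair_sqr lerDr.
exact: sqr_ge0.
Qed.

Lemma normv_pair_le (Z : TT) : normv Z <= normv (pfst Z) + normv (psnd Z).
Proof.
have a := normv_ge0 (pfst Z); have b := normv_ge0 (psnd Z).
rewrite -(@ler_pXn2r _ 2)// ?nnegrE ?addr_ge0 ?normv_ge0// normv_pair_sqr.
have : 0 <= normv (pfst Z) * normv (psnd Z) by rewrite mulr_ge0.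
lra.
Qed.
End Pairs.

Section TNNR.
Variables (R : realType) (n1 n2 n3 : nat).
Variables (rho drho : R -> R) (Lg : R).
Hypothesis rho_ge0 : forall t : R, 0 <= t -> 0 <= rho t.
Hypothesis rho_deriv : forall t : R, 0 <= t -> forall e : R, 0 < e ->
  exists2 d : R, 0 < d & forall h : R, 0 <= t + h -> `|h| < d ->
    `|rho (t + h) - rho t - drho t * h| <= e * `|h|.
Hypothesis rho_concave : forall (s t a : R), 0 <= s -> 0 <= t -> 0 <= a <= 1 ->
  a * rho s + (1 - a) * rho t <= rho (a * s + (1 - a) * t).
Hypothesis drho_lip : forall s t : R, 0 <= s -> 0 <= t ->
  `|drho s - drho t| <= Lg * `|s - t|.
Hypothesis drho_pos : forall t : R, 0 <= t -> 0 < drho t.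
Local Notation T := (tensor R n1 n2 n3).
Variables (f : T -> R) (gradf : T -> T) (Lf : R).
Hypothesis f_grad : has_gradient f gradf.
Hypothesis Lf_pos : 0 < Lf.
Hypothesis gradf_lip : forall X Y, normv (gradf X - gradf Y) <= Lf * normv (X - Y).
Variables (lam : R) (lam_pos : 0 < lam).
Local Notation F := (Fobj lam rho f).
Hypothesis F_coercive : forall M : R, exists B : R, forall X : T, B < normv X -> M < F X.
Hypothesis F_bdd_below : exists m : R, forall X : T, m <= F X.
Variables (X : nat -> T) (theta1 theta2 mu : nat -> R).
Hypothesis X_TNNR : is_TNNR_sequence lam rho drho gradf X theta1 theta2 mu.
Variables (eps : R) (eps_in : 0 < eps < 1).
Hypothesis theta1_in : forall t, 0 <= theta1 t < (1 - eps) / 2.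
Hypothesis theta2_in : forall t, 0 <= theta2 t <= 1 / 2.
Hypothesis mu_noninc : forall t, mu t.+1 <= mu t.
Hypothesis mu_le0 : forall t, mu t <= mu 0%N.
Hypothesis mu_ge1 : forall t, theta2 t * Lf <= mu t * theta1 t.
Hypothesis mu_ge2 : forall t,
  (1 - theta2 t) * Lf / (1 - theta1 t - theta1 t.+1 - eps) <= mu t.
Variables (delta : R) (delta_const : forall t, mu t * theta1 t / 2 = delta).

(** Multiplying out is legitimate because [theta1 t + theta1 t.+1 < 1 - eps] makes the denominator
    positive; [Lf / 2] comes from [theta2 t <= 1 / 2]. *)
Lemma mu_ge t : Lf / 2 <= mu t /\
  (1 - theta2 t) * Lf <= mu t * (1 - theta1 t - theta1 t.+1 - eps).
Proof.
have /andP[a0 a1] := theta1_in t; have /andP[b0 b1] := theta1_in t.+1.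
have /andP[e0 e1] := eps_in; have /andP[c0 c1] := theta2_in t.
have q0 : 0 < 1 - theta1 t - theta1 t.+1 - eps by lra.
have := mu_ge2 t; rewrite ler_pdivrMr// => H; split=> //.
have : Lf / 2 <= (1 - theta2 t) * Lf by rewrite mulrC ler_pM2r//; lra.
have m0 : 0 <= mu t.
  rewrite -(pmulr_lge0 _ q0); apply: le_trans H.
  by apply: mulr_ge0 (ltW Lf_pos); lra.
have : mu t * (1 - theta1 t - theta1 t.+1 - eps) <= mu t by rewrite ler_piMr//; lra.
lra.
Qed.

Lemma mu_gt0 t : 0 < mu t.
Proof. by have [h _] := mu_ge t; apply: lt_le_trans h; rewrite divr_gt0. Qed.

Lemma delta_ge0 : 0 <= delta.
Proof.
have /andP[a0 _] := theta1_in 0; have m0 := mu_gt0 0.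
by rewrite -(delta_const 0%N) divr_ge0// mulr_ge0// ltW.
Qed.

(** The merit function [Hfun] along consecutive iterates; as [prevX X 0] is [X 0], it starts at
    [F (X 0)]. *)
Definition hseq t : R := F (X t) + delta * normv (X t - prevX X t) ^+ 2.

Lemma YseqE t : Yseq X theta1 t = X t + scalev (theta1 t) (X t - prevX X t).
Proof. by apply/ffunP => i; rewrite !ffunE. Qed.

Lemma ZseqE t : Zseq X theta2 t = X t + scalev (theta2 t) (X t - prevX X t).
Proof. by apply/ffunP => i; rewrite !ffunE. Qed.

(** The gradient is taken at [Z], so [f (X t.+1)] and [f (X t)] are compared through the
    linearization at [Z]; what remains is a quadratic form in the steps [D] and [d]. *)
Lemma TNNR_descent t :
  hseq t.+1 <= hseq t - eps * Lf / 4 * normv (X t.+1 - X t) ^+ 2.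
Proof.
rewrite /hseq [prevX X t.+1]/=.
have [D DE] : exists D, D = X t.+1 - X t by exists (X t.+1 - X t).
have [d dE] : exists d, d = X t - prevX X t by exists (X t - prevX X t).
rewrite -DE -dE; have sub := X_TNNR t (X t); rewrite /subproblem YseqE -dE in sub.
have XY a : X t.+1 - (X t + scalev a d) = D - scalev a d by rewrite DE opprD addrA.
have XX a : X t - (X t + scalev a d) = - scalev a d.
  by rewrite opprD addrA subrr add0r.
have pm := pen_majorant rho_ge0 rho_deriv rho_concave drho_pos (X t) (X t.+1).
pose Z := Zseq X theta2 t.
have XZ : X t.+1 - Z = D - scalev (theta2 t) d by rewrite /Z ZseqE -dE XY.
have XZ' : X t - Z = - scalev (theta2 t) d by rewrite /Z ZseqE -dE XX.
have f1 := descent_lemma Lf_pos f_grad gradf_lip Z (X t.+1).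
have f2 := descent_lemma_ge Lf_pos f_grad gradf_lip Z (X t).
rewrite XZ in f1; rewrite XZ' in f2.
rewrite XY XX in sub; rewrite -/Z in sub.
rewrite -[alphaw _ _ _ _]/(alpha rho drho (X t)) in sub.
rewrite -[betaw _ _ _ _]/(beta rho drho (X t)) in sub.
rewrite !normv_sqr !dotvE in sub f1 f2 *.
rewrite (dotvC (gradf Z)) (dotvC (gradf Z)) in f1; rewrite (dotvC (gradf Z)) in f2.
rewrite (dotvC d D) in sub f1.
have key : F (X t.+1) <= F (X t) - mu t / 2 * dotv D D + mu t * theta1 t * dotv D d
    + Lf / 2 * dotv D D - Lf * theta2 t * dotv D d + Lf * theta2 t ^+ 2 * dotv d d.
  have := ler_wpM2l (ltW lam_pos) pm; rewrite /Fobj -/(pen rho (X t)) -/(pen rho (X t.+1)).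
  lra.
have [m1 m2] := mu_ge t.
have /andP[a0 a1] := theta1_in t; have /andP[b0 b1] := theta1_in t.+1.
have /andP[e0 e1] := eps_in; have /andP[c0 c1] := theta2_in t.
have DD := dotvv_ge0 D; have dd := dotvv_ge0 d.
(* [g2] absorbs the cross term, [g3] the excess in [d], and [g4] leaves [mu t * eps / 2] on [D],
   which is at least [eps * Lf / 4] by [g5]. *)
have g2 : 0 <= (mu t * theta1 t - theta2 t * Lf) * (dotv D D - 2 * dotv D d + dotv d d).
  rewrite mulr_ge0//; first by rewrite subr_ge0.
  by have := dotvv_ge0 (D - d); rewrite !dotvE (dotvC d D); lra.
have g3 : 0 <= Lf * theta2 t * (1 / 2 - theta2 t) * dotv d d.
  by rewrite !mulr_ge0// ?(ltW Lf_pos)//; lra.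
have d1 : mu t * theta1 t = 2 * delta by rewrite -(delta_const t); lra.
have d2 : 2 * delta <= mu t * theta1 t.+1.
  have -> : 2 * delta = mu t.+1 * theta1 t.+1 by rewrite -(delta_const t.+1); lra.
  by rewrite ler_wpM2r.
have g4 : 0 <= (mu t - mu t * theta1 t - (1 - theta2 t) * Lf - 2 * delta - mu t * eps)
   * dotv D D by rewrite mulr_ge0//; lra.
have g5 : 0 <= (mu t * eps - Lf / 2 * eps) * dotv D D.
  by rewrite mulr_ge0// subr_ge0 ler_wpM2r// ltW.
rewrite d1 in key g2 g4; lra.
Qed.

Lemma F_slope : exists b K, [/\ 0 < b, 0 <= K & forall t W,
  F (X t.+1) - b * (normv (X t.+1 - X t) + normv (X t - prevX X t)) * normv (W - X t.+1)
    - K * normv (W - X t.+1) ^+ 2 <= F W].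
Proof.
have [c c0 hc] := wnorm_perturb rho_ge0 rho_deriv rho_concave drho_lip drho_pos
  n1 n2 n3.
have [K K0 hK] := pen_minorant rho_ge0 rho_deriv rho_concave drho_lip drho_pos
  n1 n2 n3.
have m0 := mu_gt0 0.
(* In [b]: the change of weights, the gradient at [Z] instead of [X t.+1], the linear part of the
   proximal term. In [K]: the curvatures of the penalty, of [f] and of the proximal term. *)
exists (lam * c + Lf + mu 0%N), (lam * K + Lf / 2 + mu 0%N / 2); split.
- by rewrite ltr_wpDl// addr_ge0 ?mulr_ge0// ltW.
- by rewrite !addr_ge0 ?mulr_ge0 ?invr_ge0 // ltW.
move=> t W; set Xp := X t.+1; set D := Xp - X t; set d := X t - prevX X t.
pose Y := Yseq X theta1 t; pose Z := Zseq X theta2 t; pose V := W - Xp.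
have /andP[a0 a1] := theta1_in t; have /andP[e0 e1] := eps_in.
have /andP[c20 c21] := theta2_in t.
have sub := X_TNNR t W; rewrite /subproblem -/Y -/Z -/Xp in sub.
rewrite -[alphaw _ _ _ _]/(alpha rho drho (X t)) in sub.
rewrite -[betaw _ _ _ _]/(beta rho drho (X t)) in sub.
have WY : W - Y = V + (Xp - Y) by rewrite /V addrA subrK.
rewrite WY (normv_sqrD V) (dotvDl V) in sub.
have h1 := ler_wpM2l (ltW lam_pos) (hc (X t) Xp W).
have h2 := ler_wpM2l (ltW lam_pos) (hK Xp W).
have h3 := descent_lemma_ge Lf_pos f_grad gradf_lip Xp W.
rewrite -/V in h1 h2 h3 *.
have XpZ : Xp - Z = D - scalev (theta2 t) d by rewrite /Z ZseqE opprD addrA.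
have XpY : Xp - Y = D - scalev (theta1 t) d by rewrite /Y YseqE opprD addrA.
have d0 := normv_ge0 d; have D0 := normv_ge0 D; have V0 := normv_ge0 V.
have bd a : 0 <= a <= 1 -> normv (D - scalev a d) <= normv D + normv d.
  move=> /andP[aa0 aa1]; rewrite (le_trans (ler_normvB _ _))// lerD2l normvZ ger0_norm//.
  by rewrite ler_piMl.
have n1' : normv (Xp - Y) <= normv D + normv d by rewrite XpY bd//; apply/andP; split; lra.
have n2' : normv (Xp - Z) <= normv D + normv d by rewrite XpZ bd//; apply/andP; split; lra.
have g1 : - (Lf * (normv D + normv d) * normv V) <= dotv (gradf Xp) V - dotv V (gradf Z).
  rewrite (dotvC V) -dotvNl -dotvDl; apply: le_trans (dotv_ge _ _).
  rewrite lerN2 ler_wpM2r// (le_trans (gradf_lip _ _))// ler_wpM2l// ltW//.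
have mt := mu_gt0 t.
have g2 : - (mu 0%N * (normv D + normv d) * normv V) <= - (mu t * dotv V (Xp - Y)).
  rewrite lerN2; apply: le_trans (ler_wpM2l (ltW mt) (dotv_le _ _)) _.
  rewrite (mulrC (normv V)) mulrA ler_wpM2r// ler_pM ?normv_ge0// ?ltW// mu_le0.
have g3 : - (mu 0%N / 2 * normv V ^+ 2) <= - (mu t / 2 * normv V ^+ 2).
  by rewrite lerN2; apply: ler_wpM2r; [exact: sqr_ge0 | rewrite ler_pM2r ?invr_gt0 ?mu_le0].
have nD : normv (X t - Xp) = normv D by rewrite normvBC.
rewrite nD in h1.
have g4 : 0 <= lam * c * normv d * normv V.
  by apply: mulr_ge0 V0; apply: mulr_ge0 d0; exact: mulr_ge0 (ltW lam_pos) c0.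
rewrite /Fobj -/(pen rho W) -/(pen rho Xp); lra.
Qed.

Lemma F_continuous x e : 0 < e -> exists2 d : R, 0 < d &
  forall y, normv (y - x) < d -> `|F y - F x| < e.
Proof.
move=> e0.
have [c c0 hc] := pen_lip rho_ge0 rho_deriv rho_concave drho_pos n1 n2 n3.
have [d d0 hd] := f_grad x ltr01.
have l0 := lam_pos; have lc : 0 <= lam * c by rewrite mulr_ge0// ltW.
pose C := lam * c + normv (gradf x) + 1.
have C0 : 0 < C by have := normv_ge0 (gradf x); rewrite /C; lra.
exists (Num.min d (e / C)); first by rewrite lt_min d0 divr_gt0.
move=> y; rewrite lt_min ltr_pdivlMr// => /andP[yd yC].
have := hd _ yd; rewrite (addrC x (y - x)) subrK mul1r => fy.
apply: le_lt_trans yC; rewrite /Fobj -/(pen rho y) -/(pen rho x).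
have -> : lam * pen rho y + f y - (lam * pen rho x + f x) =
  lam * (pen rho y - pen rho x) + (f y - f x - dotv (gradf x) (y - x))
  + dotv (gradf x) (y - x) by ring.
apply: le_trans (ler_normD _ _) _; apply: le_trans (lerD (ler_normD _ _) (lexx _)) _.
have p1 : `|lam * (pen rho y - pen rho x)| <= lam * (c * normv (y - x)).
  by rewrite normrM (gtr0_norm lam_pos) ler_pM2l.
have := cauchy_schwarz (gradf x) (y - x); rewrite /C; lra.
Qed.

Lemma step_gt0 : 0 < eps * Lf / 4.
Proof. by case/andP: eps_in => e0 _; rewrite divr_gt0// mulr_gt0. Qed.

Lemma hseq_anti t k : (t <= k)%N -> hseq k <= hseq t.
Proof.
move=> tk; rewrite -(subnKC tk); elim: (k - t)%N => [|j IH]; first by rewrite addn0.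
rewrite addnS; have := TNNR_descent (t + j).
have : 0 <= eps * Lf / 4 * normv (X (t + j).+1 - X (t + j)%N) ^+ 2.
  by apply: mulr_ge0 (sqr_ge0 _); exact: ltW step_gt0.
lra.
Qed.

Lemma F_le_hseq t : F (X t) <= hseq t.
Proof. by rewrite lerDl; apply: mulr_ge0 delta_ge0 (sqr_ge0 _). Qed.

Lemma step_cvg0 e : 0 < e ->
  exists N, forall t, (N <= t)%N -> normv (X t.+1 - X t) < e.
Proof.
have [m hm] := F_bdd_below.
apply: (@sqr_summand_cvg0 R hseq _ (eps * Lf / 4) m step_gt0).
- by move=> t; exact: normv_ge0.
- by move=> t; apply: le_trans (F_le_hseq t).
- exact: TNNR_descent.
Qed.

(** [F] stays below [hseq 0], so coercivity bounds the iterates. The shift by two lets [prevX]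
    compute and leaves room for the two earlier iterates in the slope. *)
Lemma TNNR_cluster : exists Xs : T, forall e, 0 < e -> forall N,
  exists2 t, (N <= t)%N & normv (X t.+2 - Xs) < e.
Proof.
have [B hB] := F_coercive (hseq 0).
apply: (@bounded_cluster R _ (fun t => X t.+2) B) => t.
rewrite leNgt; apply/negP => /hB; apply/negP; rewrite -leNgt.
exact: le_trans (F_le_hseq _) (hseq_anti (leq0n _)).
Qed.

(** * Passage to the limit at a cluster point *)

Section ClusterPoint.
Variable Xs : T.
Hypothesis Xs_cluster : forall e, 0 < e -> forall N,
  exists2 t, (N <= t)%N & normv (X t.+2 - Xs) < e.

Lemma cluster_near e N : 0 < e -> exists2 t, (N <= t)%N &
  [/\ normv (X t.+2 - Xs) < e, `|F (X t.+2) - F Xs| < e,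
      normv (X t.+2 - X t.+1) < e & normv (X t.+1 - X t) < e].
Proof.
move=> e0; have [d d0 hd] := F_continuous Xs e0.
have [N' hN'] := step_cvg0 e0.
have m0 : 0 < Num.min e d by rewrite lt_min e0.
have [t] := Xs_cluster m0 (maxn N N').
rewrite geq_max lt_min => /andP[Nt N't] /andP[te td].
by exists t => //; split=> //; [exact: hd | exact/hN'/leqW | exact: hN'].
Qed.

Lemma hseq_ge_limit t : F Xs <= hseq t.
Proof.
rewrite leNgt; apply/negP => lt; have g0 : 0 < F Xs - hseq t by rewrite subr_gt0.
have [k tk [_ + _ _]] := cluster_near t g0; rewrite ltr_norml => /andP[h1 _].
have := F_le_hseq k.+2; have := hseq_anti (leqW (leqW tk)); lra.
Qed.

Lemma hseq_cvg e : 0 < e -> exists N, forall t, (N <= t)%N -> hseq t < F Xs + e.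
Proof.
move=> e0; pose q := e / (delta + 1).
have D0 := delta_ge0; have D1 : 0 < delta + 1 by lra.
have m0 : 0 < Num.min 1 q by rewrite lt_min ltr01 divr_gt0.
have [t _ [_ + + _]] := cluster_near 0 m0.
rewrite !lt_min => /andP[_ Fq] /andP[n1' nq].
exists t.+2 => k tk; apply: le_lt_trans (hseq_anti tk) _; rewrite /hseq [prevX _ _]/=.
move: Fq; rewrite ltr_norml => /andP[_ Fq].
have qe : q * (delta + 1) = e by rewrite divfK ?gt_eqF.
have n0 := normv_ge0 (X t.+2 - X t.+1).
have nn : normv (X t.+2 - X t.+1) ^+ 2 <= q.
  by rewrite expr2 (le_trans _ (ltW nq))// ler_piMl// ltW.
have := ler_wpM2l D0 nn; lra.
Qed.

Lemma F_slope_limit : exists2 K, 0 <= K & forall W, F Xs - K * normv (W - Xs) ^+ 2 <= F W.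
Proof.
have [b [K [b0 K0 slope]]] := F_slope; exists K => // W.
set n := normv (W - Xs); have n0 : 0 <= n := normv_ge0 _.
apply/ler_addgt0Pr => e e0.
(* Per unit of [q], the summands bound the error in the value of [F], the slope term, and the cost
   of recentring the quadratic at [Xs]. *)
pose C := 1 + 2 * b * (n + 1) + K * (2 * n + 1).
have Kn : 0 <= K * (2 * n + 1) by rewrite mulr_ge0//; lra.
have bn : 0 <= b * (n + 1) by rewrite mulr_ge0//; lra.
have C0 : 0 < C by rewrite /C; lra.
have m0 : 0 < Num.min 1 (e / C) by rewrite lt_min ltr01 divr_gt0.
have [t _] := cluster_near 0 m0; set q := Num.min 1 (e / C) in m0 * => -[xq Fq d1 d0].
have q1 : q <= 1 by rewrite ge_min lexx.
have qC : q * C <= e by rewrite -ler_pdivlMr// ge_min lexx orbT.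
have := slope t.+1 W; rewrite [prevX _ _]/=.
set D := normv (X t.+2 - X t.+1) in d1 *; set D' := normv (X t.+1 - X t) in d0 *.
have D'0 : 0 <= D' := normv_ge0 _; have D0 : 0 <= D := normv_ge0 _.
set p := normv (W - X t.+2); have p0 : 0 <= p := normv_ge0 _.
have pn : p <= n + q.
  by apply: le_trans (ler_distvD Xs _ _) _; rewrite lerD2l normvBC ltW.
have s1 : b * (D + D') * p <= b * (2 * q) * (n + 1).
  have z0 : 0 <= b * (D + D') by rewrite mulr_ge0 ?addr_ge0// ltW.
  by apply: ler_pM => //; [rewrite ler_pM2l//; lra | lra].
have p2 : p ^+ 2 <= n ^+ 2 + q * (2 * n + 1).
  have : p ^+ 2 <= (n + q) ^+ 2 by rewrite ler_pXn2r ?nnegrE//; lra.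
  have : q ^+ 2 <= q by rewrite expr2 ler_piMl// ltW.
  lra.
have s2 := ler_wpM2l K0 p2.
move: Fq; rewrite ltr_norml => /andP[Fq _].
move: qC; rewrite /C; lra.
Qed.
End ClusterPoint.

Local Notation H := (Hfun lam rho f delta).

Lemma H_slope : exists b K, [/\ 0 < b, 0 <= K & forall t z Z,
  z = pairv (X t.+2) (X t.+1) ->
  H z - b * (normv (X t.+2 - X t.+1) + normv (X t.+1 - X t)) * normv (Z - z)
    - K * normv (Z - z) ^+ 2 <= H Z].
Proof.
have [b [K [b0 K0 slope]]] := F_slope; have D0 := delta_ge0.
exists (b + 4 * delta), K; split=> [||t z Z zE] //; first by lra.
have := slope t.+1 (pfst Z); rewrite /Hfun [prevX _ _]/=.
have := normv_pfst (Z - z); have := normv_psnd (Z - z).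
rewrite pfstB psndB.
have -> : pfst z = X t.+2 by rewrite zE pfst_pairv.
have -> : psnd z = X t.+1 by rewrite zE psnd_pairv.
set u := pfst Z - X t.+2; set w := psnd Z - X t.+1; set n := normv (Z - z).
have -> : pfst Z - psnd Z = (X t.+2 - X t.+1) + (u - w).
  by rewrite /u /w; apply/ffunP => i; rewrite !ffunE; ring.
rewrite (normv_sqrD (X t.+2 - X t.+1)) => wn un.
have := dotv_ge (X t.+2 - X t.+1) (u - w); have := ler_normvB u w.
set D := normv (X t.+2 - X t.+1); set D' := normv (X t.+1 - X t).
set E := normv (u - w); set dt := dotv _ _ => Euw dte.
have u0 := normv_ge0 u; have Dn := normv_ge0 (X t.+2 - X t.+1); rewrite -/D in Dn.
have D'n : 0 <= D' := normv_ge0 _.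
have n0 : 0 <= n := normv_ge0 _.
have h1 : D * E <= D * (2 * n) by rewrite ler_wpM2l//; lra.
have h2 : delta * (- (D * (2 * n))) <= delta * dt by rewrite ler_wpM2l//; lra.
have h3 : b * (D + D') * normv u <= b * (D + D') * n.
  by rewrite ler_wpM2l// mulr_ge0 ?addr_ge0// ltW.
have h4 : K * normv u ^+ 2 <= K * n ^+ 2.
  by rewrite ler_wpM2l// ler_pXn2r ?nnegrE.
have h5 : 0 <= delta * E ^+ 2 by rewrite mulr_ge0 ?sqr_ge0.
have h6 : 0 <= delta * D' * n by rewrite mulr_ge0// mulr_ge0.
lra.
Qed.

Lemma TNNR_KL_convergence : KL_function H ->
  (exists B : R, forall N : nat, \sum_(t < N) normv (X t.+1 - X t) <= B) /\
  (exists Xs : T, cvgv X Xs /\ critical_point F Xs).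
Proof.
move=> [Hlsc HKL].
have [Xs cl] := TNNR_cluster.
have [Ks Ks0 Fs] := F_slope_limit cl.
have D0 := delta_ge0.
pose zs := pairv Xs Xs.
have Hzs : H zs = F Xs.
  by rewrite /Hfun pfst_pairv psnd_pairv subrr normv0 expr0n mulr0 addr0.
have FH Z : F (pfst Z) <= H Z by rewrite lerDl; apply: mulr_ge0 D0 (sqr_ge0 _).
(* [KL_function] yields the inequality only where the subdifferential is inhabited; the vanishing
   slope at [Xs] supplies [0]. *)
have H0 : limiting_subdiff H zs 0.
  apply/frechet_limiting/(@quadratic_minorant_frechet _ _ _ _ _ Ks Ks0) => Z.
  rewrite dotv0l addr0 Hzs; apply: le_trans (FH Z); apply: le_trans (Fs _).
  rewrite lerD2l lerN2 ler_wpM2l// ler_pXn2r ?nnegrE ?normv_ge0//.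
  by have := normv_pfst (Z - zs); rewrite pfstB pfst_pairv.
have [eta [r [phi [dphi [eta0 r0 [phi0 phi_ge phi_cont phi_conc
  [phi_der dphi_cont dphi_pos]] KL]]]]] := HKL zs (ex_intro _ _ H0).
have [b [K [b0 K0 slope]]] := H_slope.
have [m hm] := F_bdd_below.
have Hm Z : m <= H Z by exact: le_trans (hm _) (FH Z).
(* Components within [r / 2] put the pair in the KL ball of radius [r]; the factor [4] in [4 * b] is
   that of [KL_slope]. *)
have r2 : 0 < r / 2 by rewrite divr_gt0.
have b4 : 0 < 4 * b by rewrite mulr_gt0.
have e00 : 0 <= (0 : R) < eta by rewrite lexx.
have phi_c0 e : 0 < e -> exists2 d : R, 0 < d &
    forall t, 0 <= t < eta -> `|t| < d -> phi t < e.
  move=> e0; have [d d0 hd] := phi_cont 0 e00 e e0; exists d => // t t01 td.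
  have := hd t t01; rewrite subr0 phi0 subr0 => /(_ td); exact: le_lt_trans (ler_norm _).
have phi_tan s t : 0 < s < eta -> 0 <= t < eta -> phi t <= phi s + dphi s * (t - s).
  move=> s01 t01; case/andP: (s01) => s0 s1; case/andP: (t01) => t0 t1.
  apply: concave_tangent => [c c01|e e0].
    by apply: phi_conc => //; rewrite (ltW s0).
  have [d d0 hd] := phi_der s s01 e e0; exists d => // c /andP[c0 c1] cd.
  (* Since [c < 1] and [s > 0], the point stays strictly inside the interval where [phi] is
     differentiable, even for [t = 0]. *)
  apply: hd => //; have c10 : 0 < 1 - c by lra.
  have -> : s + c * (t - s) = c * t + (1 - c) * s by ring.
  have q1 : 0 <= c * t by rewrite mulr_ge0// ltW.
  have q2 : 0 < (1 - c) * s by rewrite mulr_gt0.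
  have q3 : c * t <= c * eta by rewrite ler_pM2l// ltW.
  have q4 : (1 - c) * s < (1 - c) * eta by rewrite ltr_pM2l.
  by apply/andP; split; lra.
have hslope t : normv (X t.+2 - Xs) < r / 2 -> normv (X t.+1 - Xs) < r / 2 ->
    F Xs < hseq t.+2 < F Xs + eta ->
    1 <= dphi (hseq t.+2 - F Xs) *
      (4 * b * (normv (X t.+2 - X t.+1) + normv (X t.+1 - X t))).
  move=> x2 x1; set z := pairv (X t.+2) (X t.+1).
  have Hz : hseq t.+2 = H z by rewrite /Hfun pfst_pairv psnd_pairv.
  rewrite Hz -Hzs -(mulrA 4) => hz.
  apply: (KL_slope Hlsc Hm _ K0 dphi_cont dphi_pos KL (fun Z => slope t z Z erefl)) => //.
    by rewrite mulr_ge0 ?addr_ge0 ?normv_ge0// ltW.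
  apply: le_lt_trans (normv_pair_le _) _; rewrite pfstB psndB !pfst_pairv !psnd_pairv.
  lra.
split.
  exact: (KL_sequence_length step_gt0 b4 eta0 r2 TNNR_descent (hseq_ge_limit cl)
    (hseq_cvg cl) cl phi_ge phi_c0 phi_tan dphi_pos hslope).
exists Xs; split.
  exact: (KL_sequence_cvg step_gt0 b4 eta0 r2 TNNR_descent (hseq_ge_limit cl)
    (hseq_cvg cl) cl phi_ge phi_c0 phi_tan dphi_pos hslope).
apply/frechet_limiting/(@quadratic_minorant_frechet _ _ _ _ _ Ks Ks0) => W.
by rewrite dotv0l addr0.
Qed.

End TNNR.

Theorem theorem3 (R : realType) (n1 n2 n3 : nat)
  (hn1 : (0 < n1)%N) (hn2 : (0 < n2)%N) (hn3 : (0 < n3)%N)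
  (* A1 *)
  (rho drho : R -> R) (Lg : R)
  (rho_ge0 : forall t : R, 0 <= t -> 0 <= rho t)
  (rho_deriv : forall t : R, 0 <= t -> forall e : R, 0 < e -> exists2 d : R, 0 < d &
      forall h : R, 0 <= t + h -> `|h| < d ->
        `|rho (t + h) - rho t - drho t * h| <= e * `|h|)
  (rho_concave : forall (s t a : R), 0 <= s -> 0 <= t -> 0 <= a <= 1 ->
      a * rho s + (1 - a) * rho t <= rho (a * s + (1 - a) * t))
  (drho_lip : forall s t : R, 0 <= s -> 0 <= t -> `|drho s - drho t| <= Lg * `|s - t|)
  (drho_pos : forall t : R, 0 <= t -> 0 < drho t)
  (* A2 *)
  (f : tensor R n1 n2 n3 -> R) (gradf : tensor R n1 n2 n3 -> tensor R n1 n2 n3) (Lf : R)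
  (f_ge0 : forall X, 0 <= f X)
  (f_grad : has_gradient f gradf)
  (Lf_pos : 0 < Lf)
  (gradf_lip : forall X Y, normv (gradf X - gradf Y) <= Lf * normv (X - Y))
  (* objective *)
  (lam : R) (lam_pos : 0 < lam)
  (* A3 *)
  (F_coercive : forall M : R, exists B : R, forall X : tensor R n1 n2 n3,
      B < normv X -> M < Fobj lam rho f X)
  (F_bdd_below : exists m : R, forall X : tensor R n1 n2 n3, m <= Fobj lam rho f X)
  (* iteration *)
  (X : nat -> tensor R n1 n2 n3) (theta1 theta2 mu : nat -> R)
  (X_TNNR : is_TNNR_sequence lam rho drho gradf X theta1 theta2 mu)
  (* A4 *)
  (eps : R) (eps_in : 0 < eps < 1)
  (theta1_in : forall t, 0 <= theta1 t < (1 - eps) / 2)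
  (theta2_in : forall t, 0 <= theta2 t <= 1 / 2)
  (mu_noninc : forall t, mu t.+1 <= mu t)
  (mu_le0 : forall t, mu t <= mu 0%N)
  (mu_ge1 : forall t, theta2 t * Lf <= mu t * theta1 t)
  (mu_ge2 : forall t, (1 - theta2 t) * Lf / (1 - theta1 t - theta1 t.+1 - eps) <= mu t)
  (* delta_t constant *)
  (delta : R) (delta_const : forall t, mu t * theta1 t / 2 = delta)
  (* H is a KL function *)
  (H_KL : KL_function (Hfun lam rho f delta)) :
  (exists B : R, forall N : nat, \sum_(t < N) normv (X t.+1 - X t) <= B) /\
  (exists Xs : tensor R n1 n2 n3, cvgv X Xs /\ critical_point (Fobj lam rho f) Xs).
Proof.
exact: (TNNR_KL_convergence rho_ge0 rho_deriv rho_concave drho_lip drho_pos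
  f_grad Lf_pos gradf_lip lam_pos F_coercive F_bdd_below X_TNNR eps_in theta1_in
  theta2_in mu_noninc mu_le0 mu_ge1 mu_ge2 delta_const H_KL).
Qed.
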